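(* The consistently oriented double ray is ubiquitous if and only if it is ubiquitous restricted to the class of one-ended digraphs. That is, the following two statements are equivalent: (a) every digraph $D$ that contains, for every $n\in\mathbb N$, a set of $n$ pairwise disjoint double rays contains infinitely many pairwise disjoint double rays; (b) every digraph $D$ with exactly one end that contains, for every $n\in\mathbb N$, a set of $n$ pairwise disjoint double rays contains infinitely many pairwise disjoint double rays.
   Context: Digraphs may be infinite. ''$D$ contains $X$'' means that $X$ is a subdigraph of $D$ (subdigraph relation); disjoint means vertex-disjoint. A dipath is a (finite) directed path. For vertex sets $A,B$, an $A$--$B$ dipath is a dipath that starts at a vertex of $A$, ends at a vertex of $B$ and is internally disjoint from $A\cup B$; for subdigraphs $Q,R$, a $Q$--$R$ dipath is a $V(Q)$--$V(R)$ dipath. A ray is a digraph with precisely one vertex $v$ of out-degree $1$ and in-degree $0$, with a dipath from $v$ to each of its vertices, and all of whose vertices other than $v$ have out-degree $1$ and in-degree $1$. An anti-ray is obtained from a ray by reversing all edges. A (consistently oriented) double ray is an infinite digraph all of whose vertices have in- and out-degree $1$ and such that for all vertices $v,w$ there exists a $v$--$w$ or a $w$--$v$ dipath. For rays or anti-rays $Q,R$ in a digraph $D$ write $Q\le R$ if there are infinitely many pairwise disjoint $Q$--$R$ dipaths in $D$, and $Q\sim R$ if $Q\le R$ and $R\le Q$. Then $\sim$ is an equivalence relation on the set of all rays and anti-rays in $D$, and its equivalence classes are the ends of $D$. A digraph is one-ended if it has exactly one end. A digraph $H$ is ubiquitous (restricted to a class $\mathcal C$ of digraphs) if every digraph $D$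 (in $\mathcal C$) that contains $n$ pairwise disjoint copies of $H$ for all $n\in\mathbb N$ contains $\aleph_0$ many pairwise disjoint copies of $H$. *)

(* Defs.v *)
From mathcomp Require Import all_boot.
From mathcomp Require Import boolp classical_sets functions cardinality.

Set Implicit Arguments.
Unset Strict Implicit.
Unset Printing Implicit Defensive.

Local Open Scope classical_set_scope.

(* Digraphs without loops and parallel edges (opposite edges are allowed).
   The vertices form a set in an ambient type [T], so that a digraph and its
   subdigraphs all have the same type [digraph T]. *)
Record digraph (T : Type) := Digraph {
  verts : set T;
  edge : T -> T -> Prop;
  edge_verts : forall x y, edge x y -> verts x /\ verts y;
  edge_irrefl : forall x, ~ edge x x }.

Definition subdigraph (T : Type) (H G : digraph T) : Prop :=
  verts H `<=` verts G /\ (forall x y, edge H x y -> edge G x y).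

Lemma reverse_edge_verts (T : Type) (G : digraph T) (x y : T) :
  edge G y x -> verts G x /\ verts G y.
Proof. by move=> yx; have [] := edge_verts yx. Qed.

Definition reverse (T : Type) (G : digraph T) : digraph T :=
  {| verts := verts G;
     edge := fun x y => edge G y x;
     edge_verts := @reverse_edge_verts T G;
     edge_irrefl := @edge_irrefl T G |}.

Definition isomorphic (U T : Type) (H : digraph U) (G : digraph T) : Prop :=
  exists2 f : verts H -> verts G, bijective f &
    forall x y, edge H (val x) (val y) <-> edge G (val (f x)) (val (f y)).

Definition outdeg (T : Type) (G : digraph T) (x : T) (k : nat) : Prop :=
  ([set y | edge G x y] #= `I_k)%card.

Definition indeg (T : Type) (G : digraph T) (x : T) (k : nat) : Prop :=
  ([set y | edge G y x] #= `I_k)%card.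

(* [p 0, ..., p n] are the consecutive vertices of a dipath of length [n];
   [n = 0] gives the trivial dipaths, consisting of a single vertex. *)
Definition dipath (T : Type) (G : digraph T) (n : nat) (p : 'I_n.+1 -> T)
    : Prop :=
  [/\ injective p, forall i, verts G (p i) &
      forall i j : 'I_n.+1, j = i.+1 :> nat -> edge G (p i) (p j)].

Definition linked (T : Type) (G : digraph T) (x y : T) : Prop :=
  exists n (p : 'I_n.+1 -> T), [/\ dipath G p, p ord0 = x & p ord_max = y].

Definition dipath_between (T : Type) (G : digraph T) (A B : set T) (n : nat)
    (p : 'I_n.+1 -> T) : Prop :=
  [/\ dipath G p, A (p ord0), B (p ord_max) &
      forall i, i <> ord0 -> i <> ord_max -> ~ (A `|` B) (p i)].

Definition ray (T : Type) (G : digraph T) : Prop :=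
  exists v, [/\ unique (fun u => [/\ verts G u, outdeg G u 1 & indeg G u 0]) v,
    forall w, verts G w -> linked G v w &
    forall w, verts G w -> w <> v -> outdeg G w 1 /\ indeg G w 1].

Definition antiray (T : Type) (G : digraph T) : Prop := ray (reverse G).

Definition double_ray (T : Type) (G : digraph T) : Prop :=
  [/\ infinite_set (verts G),
    forall v, verts G v -> outdeg G v 1 /\ indeg G v 1 &
    forall v w, verts G v -> verts G w -> linked G v w \/ linked G w v].

Definition ray_le (T : Type) (D Q R : digraph T) : Prop :=
  exists (n : nat -> nat) (p : forall k, 'I_(n k).+1 -> T),
    (forall k, dipath_between D (verts Q) (verts R) (p k)) /\
    trivIset setT (fun k => range (p k)).

Definition ray_equiv (T : Type) (D Q R : digraph T) : Prop :=
  ray_le D Q R /\ ray_le D R Q.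

Definition ray_or_antiray_in (T : Type) (D Q : digraph T) : Prop :=
  subdigraph Q D /\ (ray Q \/ antiray Q).

Definition is_end (T : Type) (D : digraph T) (w : set (digraph T)) : Prop :=
  exists2 R, ray_or_antiray_in D R &
    w = [set Q | ray_or_antiray_in D Q /\ ray_equiv D Q R].

Definition one_ended (T : Type) (D : digraph T) : Prop :=
  exists! w, is_end D w.

(* A family, indexed by [I], of pairwise disjoint subdigraphs of [D] that
   satisfy [P]. *)
Definition contains_disjoint (I T : Type) (P : digraph T -> Prop)
    (D : digraph T) : Prop :=
  exists F : I -> digraph T,
    (forall i, subdigraph (F i) D /\ P (F i)) /\
    trivIset setT (fun i => verts (F i)).

Definition ubiquitous_in (C : forall T : Type, digraph T -> Prop)
    (U : Type) (H : digraph U) : Prop :=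
  forall (T : Type) (D : digraph T), C T D ->
    (forall n, contains_disjoint 'I_n (isomorphic H) D) ->
    contains_disjoint nat (isomorphic H) D.

Definition ubiquitous (U : Type) (H : digraph U) : Prop :=
  ubiquitous_in (fun _ _ => True) H.

(* Main.v *)
Require Import Defs.
From mathcomp Require Import all_boot all_order all_algebra zify.
From mathcomp Require Import boolp classical_sets functions cardinality.

(* Suppose that D contains arbitrarily, but not infinitely, many disjoint double
   rays. After deleting finitely many double rays, no double ray can be deleted
   from D any more without bounding the number of disjoint double rays. Let
   (U, X) be a cut: X is finite and no edge of D - X leaves U. Arbitrarily many
   disjoint double rays that cross the cut would give infinitely many, by
   switching (as in Pym's linkage theorem) independently on both sides. Hence
   exactly one side of each cut is large, and the large sides generate a filter.
   Call a ray or anti-ray convergent if it is eventually in each large side of a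
   cut. If there are arbitrarily many disjoint double rays whose negative halves
   do not converge, then infinitely many disjoint ones are built one after the
   other, each new one on the large side of a cut that separates it from the
   earlier negative halves; the positive halves are rerouted by switching. So
   there are arbitrarily many disjoint double rays with both halves convergent.
   Any two convergent halves are linked outside each finite set, and a union of
   finite families of such double rays, further and further away, and of finite
   linking paths is a one-ended subdigraph with arbitrarily many disjoint double
   rays. *)

Set Implicit Arguments.
Unset Strict Implicit.
Unset Printing Implicit Defensive.

Import Order.TTheory GRing.Theory Num.Theory.
Local Open Scope classical_set_scope.

(** * Switching *)

Definition jointly_injective (I A T : Type) (f : I -> A -> T) : Prop :=
  forall i j x y, f i x = f j y -> i = j /\ x = y.

Section Switching.
Local Open Scope ring_scope.
Variables (T : Type) (E : T -> T -> Prop) (I K : finType).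
Variables (r : I -> nat -> T) (s : K -> int -> T).
Hypotheses (injr : jointly_injective r) (injs : jointly_injective s).
Hypotheses (Er : forall i t, E (r i t) (r i t.+1)).
Hypotheses (Es : forall k z, E (s k z) (s k (z + 1))).

(* [p i] is how far the ray [r i] has come in deferred acceptance: it has been
   rejected at each earlier vertex on a double ray, in favour of a proposal made
   further along that double ray. *)
Definition justified (p : I -> nat) : Prop :=
  forall i t k z, (t < p i)%N -> r i t = s k z ->
    exists j u w, [/\ (u <= p j)%N, z < w & r j u = s k w].

Lemma justified_max p q : justified p -> justified q ->
  justified (fun i => maxn (p i) (q i)).
Proof.
move=> Jp Jq i t k z; rewrite leq_max => /orP[] lt e.
- have [j [u [w [uj zw e']]]] := Jp _ _ _ _ lt e.
  by exists j, u, w; split=> //; rewrite leq_max uj.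
- have [j [u [w [uj zw e']]]] := Jq _ _ _ _ lt e.
  by exists j, u, w; split=> //; rewrite leq_max uj orbT.
Qed.

(** The limit of deferred acceptance, described without an order of the proposals: justified stages
    are closed under maxima, so their union is the outcome. It may contain a whole ray. *)
Definition visited (i : I) (t : nat) : Prop :=
  exists2 p, justified p & (t <= p i)%N.

Lemma visited0 i : visited i 0.
Proof. by exists (fun=> 0%N). Qed.

(** Ray [i] stops only at a proposal that is never rejected: if [r i t] were on no double ray, or
    were overtaken there by a visited vertex, then one more step of [i] would again be justified. *)
Lemma stuck i t : visited i t -> ~ visited i t.+1 ->
  exists k z, r i t = s k z /\
    forall j u w, visited j u -> z < w -> r j u <> s k w.
Proof.
move=> [p Jp tp] nv.
have pt q : justified q -> (t <= q i)%N -> q i = t.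
  move=> Jq tq; apply/eqP; rewrite eqn_leq tq andbT leqNgt.
  by apply/negP => lt; apply: nv; exists q.
have step q : justified q -> (t <= q i)%N ->
    (forall k z, r i t = s k z ->
      exists j u w, [/\ (u <= q j)%N, z < w & r j u = s k w]) -> False.
  move=> Jq tq h; apply: nv; exists (fun j => if j == i then t.+1 else q j).
    move=> i' t' k z.
    have {}h : ((t' < q i') \/ i' = i /\ t' = t)%N -> r i' t' = s k z ->
       exists j u w, [/\ (u <= if j == i then t.+1 else q j)%N, z < w
          & r j u = s k w].
      move=> h1 e.
      have [j [u [w [uj zw e']]]] :
          exists j u w, [/\ (u <= q j)%N, z < w & r j u = s k w].
        by case: h1 => [h1|[? ?]]; [exact: Jq e | subst; exact: h].
      exists j, u, w; split=> //; case: eqP => // ji.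
      by move: uj; rewrite ji (pt q) // => /leqW.
    move=> lt; apply: h.
    case: eqP lt => [->|_] lt; last by left.
    rewrite (pt q) //; move: lt; rewrite ltnS leq_eqVlt => /orP[/eqP->|]; auto.
  by rewrite eqxx.
apply: contrapT => hn.
apply: (step p Jp tp) => k z e.
apply: contrapT => hn2; apply: hn; exists k, z; split=> // j u w [q Jq uq] zw e'.
(* A visited rival beyond [z] comes with a stage [q] of its own; the maximum of [p] and [q] contains
   both proposals. *)
apply: (step (fun i => maxn (p i) (q i)) (justified_max Jp Jq)).
  by rewrite leq_max tp.
move=> k' z' e2; have [? ?] : k = k' /\ z = z' by apply: injs; rewrite -e.
by subst; exists j, u, w; split=> //; rewrite leq_max uq orbT.
Qed.

Definition follows (i : I) (f : nat -> T) : Prop :=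
  (forall t, visited i t /\ f t = r i t) \/
  exists t0 k z,
    [/\ r i t0 = s k z,
      (forall j u w, visited j u -> z < w -> r j u <> s k w),
      (forall t, (t <= t0)%N -> visited i t /\ f t = r i t) &
      forall t, (t0 < t)%N -> f t = s k (z + (t - t0)%N%:Z)].

Lemma follows_ex i : exists f, follows i f.
Proof.
case: (pselect (forall t, visited i t)) => [all|/existsNP nall].
  by exists (r i); left.
have ex : exists t, `[< ~ visited i t >] by case: nall => t h; exists t; apply/asboolP.
case: (ex_minnP ex) => -[|t0] /asboolP nv minv.
  by case: nv; exact: visited0.
have v t : (t <= t0)%N -> visited i t.
  move=> tt0; apply: contrapT => /asboolP /minv.
  by rewrite ltnNge tt0.
have [k [z [e h]]] := stuck (v _ (leqnn _)) nv.
exists (fun t => if (t <= t0)%N then r i t else s k (z + (t - t0)%N%:Z)).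
right; exists t0, k, z; split=> // t tt0.
- by rewrite tt0; split=> //; apply: v.
- by rewrite leqNgt tt0.
Qed.

Lemma follows_cases i f : follows i f -> forall t,
  (visited i t /\ f t = r i t) \/
  exists t0 k z, [/\ visited i t0, (t0 < t)%N, r i t0 = s k z,
    (forall j u w, visited j u -> z < w -> r j u <> s k w) &
    f t = s k (z + (t - t0)%N%:Z)].
Proof.
move=> [h|[t0 [k [z [e h h1 h2]]]]] t; first by left.
case: (leqP t t0) => tt0; first by left; apply: h1.
right; exists t0, k, z; split=> //; last exact: h2.
by have [] := h1 t0 (leqnn _).
Qed.

(** No visited vertex lies strictly beyond a switching vertex, so a tail on a double ray meets no
    visited part. Two tails on the same double ray start at visited vertices, neither beyond the
    other, hence at the same vertex. *)
Lemma follows_inj (f : I -> nat -> T) :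
  (forall i, follows i (f i)) -> jointly_injective f.
Proof.
move=> hf i j x y.
have [[vi ->]|[t0 [k [z [v0 lt e h ->]]]]] := follows_cases (hf i) x;
have [[vj ->]|[t1 [k' [z' [v1 lt' e' h' ->]]]]] := follows_cases (hf j) y.
- exact: injr.
- by move=> /h'; case=> //; lia.
- by move=> /esym /h; case=> //; lia.
- move=> /injs [? ezz]; subst k'.
  have zz : z = z'.
    apply/eqP; rewrite eq_le; apply/andP; split; rewrite leNgt; apply/negP => lt2.
    - by apply: (h' _ _ _ v0 lt2).
    - by apply: (h _ _ _ v1 lt2).
  subst z'.
  have [? ?] : i = j /\ t0 = t1 by apply: injr; rewrite e e'.
  by subst; split=> //; lia.
Qed.

Lemma follows_path i f : follows i f -> forall t, E (f t) (f t.+1).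
Proof.
move=> [h|[t0 [k [z [e h h1 h2]]]]] t.
  by have [_ ->] := h t; have [_ ->] := h t.+1.
case: (ltngtP t t0) => tt0.
- by have [_ ->] := h1 _ (ltnW tt0); have [_ ->] := h1 _ tt0.
- rewrite h2 // h2; last by lia.
  have -> : z + (t.+1 - t0)%N%:Z = z + (t - t0)%N%:Z + 1 by lia.
  exact: Es.
- subst t0; have [_ ->] := h1 _ (leqnn _); rewrite h2 // e.
  have -> : z + (t.+1 - t)%N%:Z = z + 1 by lia.
  exact: Es.
Qed.

Definition met (k : K) : Prop := exists i t z, visited i t /\ r i t = s k z.

(** As [K] is finite, the maximum of one justified stage for each met double ray is a single finite
    stage that meets them all. *)
Lemma justified_all : exists2 p, justified p &
  forall k, met k -> exists i t z, (t <= p i)%N /\ r i t = s k z.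
Proof.
have /choice[q hq] k : exists p, justified p /\
    (met k -> exists i t z, (t <= p i)%N /\ r i t = s k z).
  case: (pselect (met k)) => [[i [t [z [[p Jp tp] e]]]]|nm].
    by exists p; split=> // _; exists i, t, z.
  by exists (fun=> 0%N); split.
exists (fun i => \max_k q k i) => [|k /(proj2 (hq k))[i [t [z [tq e]]]]].
  move=> i t k z; elim/big_ind: _ => //.
  - by move=> x y hx hy; rewrite leq_max => /orP[].
  - move=> k' _ lt e; have [j [u [w [uj zw e']]]] := (hq k').1 _ _ _ _ lt e.
    exists j, u, w; split=> //; exact: leq_trans (leq_bigmax k').
by exists i, t, z; split=> //; exact: leq_trans (leq_bigmax k).
Qed.

(* When [p] is justified, the last visited vertex of a met double ray can only be
   the current vertex [r i (p i)] of a ray, and this [i] determines the double ray. *)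
Lemma card_met : (#|[set k | `[< met k >]]%SET| <= #|I|)%N.
Proof.
have [p Jp hp] := justified_all.
have ex k : met k -> exists i z, r i (p i) = s k z.
  move=> /hp[i0 [t0 [z0 [tp0 e0]]]].
  pose M := \max_i p i.
  have pM i : (p i <= M)%N := leq_bigmax i.
  pose P (x : I * 'I_M.+1) := `[< (x.2 <= p x.1)%N /\ exists z, r x.1 x.2 = s k z >].
  have /choice[g hg] (x : I * 'I_M.+1) : exists z, P x -> r x.1 x.2 = s k z.
    case: (pselect (P x)) => [/asboolP[_ [z e]]|n]; first by exists z.
    by exists 0 => /n.
  have P0 : P (i0, inord t0).
    apply/asboolP; rewrite /= inordK; last by rewrite ltnS; exact: leq_trans (pM i0).
    by split=> //; exists z0.
  case: (@Order.TotalTheory.arg_maxP _ int _ (i0, inord t0) P g P0) => -[i t] Pit mx.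
  have /= e := hg _ Pit.
  move/asboolP: (Pit) => /= [tp _].
  exists i, (g (i, t)); move: tp; rewrite leq_eqVlt => /orP[/eqP <- //|lt].
  (* A position before [p i] was rejected in favour of a visited vertex further along [s k], against
     the choice of a furthest one. *)
  have [j [u [w [uj zw e']]]] := Jp _ _ _ _ lt e.
  have uM : (u < M.+1)%N by rewrite ltnS; exact: leq_trans (pM j).
  have Pju : P (j, Ordinal uM) by apply/asboolP; split=> //=; exists w.
  have /= := mx _ Pju; have /= := hg _ Pju; rewrite e' => /injs[_ <-].
  by rewrite leNgt zw.
case: (pselect (exists i : I, True)) => [[i0 _]|noI]; last first.
  have -> : [set k | `[< met k >]]%SET = finset.set0.
    apply/finset.setP => k; rewrite !inE; apply/negP => /asboolP /ex[i _].
    by apply: noI; exists i.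
  by rewrite cards0.
have /choice[g hg] k : exists i, met k -> exists z, r i (p i) = s k z.
  case: (pselect (met k)) => [mk|n]; last by exists i0.
  by have [i h] := ex _ mk; exists i.
have gi : {in [set k | `[< met k >]]%SET &, injective g}.
  move=> k k'; rewrite !inE => mk mk' gg.
  have [z e] := hg _ mk; have [z' e'] := hg _ mk'.
  by have [] : k = k' /\ z = z' by apply: injs; rewrite -e -e' gg.
by rewrite -(card_in_imset gi) max_card.
Qed.

End Switching.

(* A stable matching: the rays propose to the double rays at the vertices where
   they meet them, in their order along the ray, and a double ray prefers the
   later of two vertices. A ray switches to the double ray that it is matched
   with in the end. *)
Lemma switching (T : Type) (E : T -> T -> Prop) (I K : finType)
    (r : I -> nat -> T) (s : K -> int -> T) :
  jointly_injective r -> jointly_injective s ->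
  (forall i t, E (r i t) (r i t.+1)) ->
  (forall k z, E (s k z) (s k (z + 1)%R)) ->
  exists (r' : I -> nat -> T) (B : {set K}),
    [/\ (#|B| <= #|I|)%N, jointly_injective r',
      (forall i, r' i 0 = r i 0) /\ (forall i t, E (r' i t) (r' i t.+1)),
      (forall i t, (exists j u, r' i t = r j u) \/ (exists k z, r' i t = s k z)) &
      forall k, k \notin B -> forall i t z, r' i t <> s k z].
Proof.
move=> injr injs Er Es.
have /choice[f hf] := follows_ex injr injs.
exists f, [set k | `[< met r s k >]]%SET; split.
- exact: card_met.
- exact: follows_inj hf.
- split=> i.
    have [[_ -> //]|[t0 [k [z [_ ]]]]] := follows_cases (hf i) 0.
    by rewrite ltn0.
  exact: follows_path.
- move=> i t; have [[_ ->]|[t0 [k [z [_ _ _ _ ->]]]]] := follows_cases (hf i) t.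
    by left; exists i, t.
  by right; eexists; eexists.
- move=> k; rewrite inE => /asboolP nm i t z.
  have [[v ->]|[t0 [k' [z' [v _ e _ ->]]]]] := follows_cases (hf i) t => e'.
    by apply: nm; exists i, t, z.
  have [? _] := injs _ _ _ _ e'; subst k'.
  by apply: nm; exists i, t0, z'.
Qed.

Lemma switching_nat (T : Type) (E : T -> T -> Prop) (n m : nat)
    (r : nat -> nat -> T) (s : nat -> int -> T) :
  (forall i j x y, i < n -> j < n -> r i x = r j y -> i = j /\ x = y) ->
  (forall i j x y, i < m -> j < m -> s i x = s j y -> i = j /\ x = y) ->
  (forall i t, i < n -> E (r i t) (r i t.+1)) ->
  (forall k z, k < m -> E (s k z) (s k (z + 1)%R)) ->
  exists (r' : nat -> nat -> T) (B : seq nat),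
    [/\ size B <= n,
      (forall i j x y, i < n -> j < n -> r' i x = r' j y -> i = j /\ x = y),
      (forall i, i < n -> r' i 0 = r i 0 /\ forall t, E (r' i t) (r' i t.+1)),
      (forall i t, i < n -> (exists j u, j < n /\ r' i t = r j u) \/
         (exists k z, k < m /\ r' i t = s k z)) &
      forall k, k < m -> k \notin B -> forall i t z, i < n -> r' i t <> s k z].
Proof.
move=> injr injs Er Es.
have [] := @switching T E 'I_n 'I_m (fun i => r i) (fun k => s k).
- move=> i j x y e; have [e1 e2] := injr i j x y (ltn_ord i) (ltn_ord j) e.
  by split=> //; exact: val_inj.
- move=> i j x y e; have [e1 e2] := injs i j x y (ltn_ord i) (ltn_ord j) e.
  by split=> //; exact: val_inj.
- by move=> i t; exact: Er.
- by move=> i t; exact: Es.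
move=> r' [B [cB injr' [r'0 Er'] rs dB]].
(* Indices from [n] on take [r i] as a default value. *)
exists (fun i => if insub i is Some i' then r' i' else r i).
exists [seq val k | k <- enum B]; split.
- by move: cB; rewrite size_map -cardE card_ord.
- move=> i j x y lti ltj; rewrite !insubT => /injr' [e1 e2].
  by split=> //; have := congr1 val e1.
- by move=> i lti; rewrite insubT r'0; split=> // t; exact: Er'.
- move=> i t lti; rewrite insubT.
  have [[j [u ->]]|[k [z ->]]] := rs (Ordinal lti) t.
    by left; exists j, u.
  by right; exists k, z.
- move=> k ltk kB i t z lti; rewrite insubT; apply: (dB (Ordinal ltk)).
  by apply: contra kB => h; apply/mapP; exists (Ordinal ltk); rewrite // mem_enum.
Qed.

(** * Families of disjoint double rays *)

Section Families.
Local Open Scope ring_scope.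
Variables (T : Type) (E : T -> T -> Prop).
Implicit Types (s : int -> T) (S : nat -> int -> T) (W : set T).

Definition dray s : Prop := injective s /\ forall z, E (s z) (s (z + 1)).

Definition disjoint_drays (n : nat) S : Prop :=
  (forall i j x y, (i < n)%N -> (j < n)%N -> S i x = S j y -> i = j /\ x = y) /\
  (forall j z, (j < n)%N -> E (S j z) (S j (z + 1))).

(** Arbitrarily many disjoint double rays with property [P]; the families for different [n] may be
    unrelated. *)
Definition rich (P : (int -> T) -> Prop) : Prop :=
  forall n, exists2 S, disjoint_drays n S & forall j, (j < n)%N -> P (S j).

Definition within W s : Prop := forall z, W (s z).

Definition infinitely_many_drays W : Prop :=
  exists2 S : nat -> int -> T, jointly_injective S /\ (forall j z, E (S j z) (S j (z + 1))) &
    forall j, within W (S j).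

Lemma disjoint_drays_dray n S j : disjoint_drays n S -> (j < n)%N -> dray (S j).
Proof.
move=> [injS ES] jn; split=> [x y /injS e|z]; last exact: ES.
by have [] := e jn jn.
Qed.

Lemma disjoint_drays_le n m S : (m <= n)%N -> disjoint_drays n S -> disjoint_drays m S.
Proof.
move=> mn [injS ES]; split=> [i j x y im jm|j z jm].
  by apply: injS; exact: leq_trans mn.
by apply: ES; exact: leq_trans mn.
Qed.

Lemma disjoint_drays_select n S (l : seq nat) :
  disjoint_drays n S -> uniq l -> {in l, forall j, (j < n)%N} ->
  disjoint_drays (size l) (fun i => S (nth 0%N l i)).
Proof.
move=> [injS ES] ul ln; split=> [i j x y il jl e|j z jl].
  have [e1 e2] := injS _ _ _ _ (ln _ (mem_nth _ il)) (ln _ (mem_nth _ jl)) e.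
  by split=> //; apply/eqP; rewrite -(nth_uniq 0%N il jl ul); apply/eqP.
exact: ES (ln _ (mem_nth _ jl)).
Qed.

Lemma rich_mono P Q : (forall s, dray s -> P s -> Q s) -> rich P -> rich Q.
Proof.
move=> PQ rP n; have [S dS PS] := rP n; exists S => // j jn.
by apply: PQ (PS _ jn); exact: disjoint_drays_dray dS jn.
Qed.

Lemma rich_ex P : rich P -> exists2 s, dray s & P s.
Proof.
by move=> /(_ 1%N)[S dS PS]; exists (S 0%N); [exact: disjoint_drays_dray dS _|exact: PS].
Qed.

Lemma not_rich_le P n : ~ (exists2 S, disjoint_drays n S & forall j, (j < n)%N -> P (S j)) ->
  forall m S, disjoint_drays m S -> (forall j, (j < m)%N -> P (S j)) -> (m < n)%N.
Proof.
move=> h m S dS PS; rewrite ltnNge; apply/negP => nm; apply: h.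
exists S => [|j jn]; first exact: disjoint_drays_le dS.
by apply: PS; exact: leq_trans nm.
Qed.

(** Pigeonhole: if no [n1] disjoint double rays satisfy [Q] and no [n2] satisfy [R], then no
    [n1 + n2] satisfy [P]. *)
Lemma rich_split P Q R : (forall s, dray s -> P s -> Q s \/ R s) ->
  rich P -> rich Q \/ rich R.
Proof.
move=> PQR rP; case: (pselect (rich Q)) => [|/existsNP[n1 nQ]]; first by left.
case: (pselect (rich R)) => [|/existsNP[n2 nR]]; first by right.
exfalso; have [S dS PS] := rP (n1 + n2)%N.
pose q j := `[< Q (S j) >].
pose l1 := filter q (iota 0%N (n1 + n2)); pose l2 := filter (predC q) (iota 0%N (n1 + n2)).
have sz : (size l1 + size l2 = n1 + n2)%N.
  by rewrite !size_filter count_predC size_iota.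
have lt a : {in filter a (iota 0%N (n1 + n2)), forall j, (j < n1 + n2)%N}.
  by move=> j; rewrite mem_filter mem_iota add0n => /andP[_ /andP[_ ->]].
have u a : uniq (filter a (iota 0%N (n1 + n2))) by rewrite filter_uniq ?iota_uniq.
have := not_rich_le nQ (disjoint_drays_select dS (u _) (lt q)).
have := not_rich_le nR (disjoint_drays_select dS (u _) (lt (predC q))).
rewrite -/l1 -/l2 => h2 h1.
suff : (size l1 < n1)%N /\ (size l2 < n2)%N by lia.
split; [apply: h1|apply: h2] => j jl.
  by have := mem_nth 0%N jl; rewrite mem_filter => /andP[/asboolP].
have jl2 := mem_nth 0%N jl.
have jn := lt _ _ jl2; move: jl2; rewrite mem_filter => /andP[/= /asboolP nq _].
by case: (PQR _ (disjoint_drays_dray dS jn) (PS _ jn)).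
Qed.

(** Among [n.+1] disjoint double rays at most one contains [x]. *)
Lemma rich_avoid1 P x : rich P -> rich (fun s => P s /\ forall z, s z <> x).
Proof.
move=> rP n; have [S dS PS] := rP n.+1.
case: (pselect (exists2 j, (j < n.+1)%N & exists z, S j z = x)) => [[j jn [z ez]]|no].
  pose l := rem j (iota 0%N n.+1).
  have sl : size l = n by rewrite size_rem ?size_iota // mem_iota.
  have lP i : i \in l -> (i < n.+1)%N /\ i <> j.
    rewrite mem_rem_uniq ?iota_uniq // => /andP[/eqP ij].
    by rewrite [_ \in _]mem_iota add0n => /andP[_ ?].
  exists (fun i => S (nth 0%N l i)) => [|i il].
    rewrite -[X in disjoint_drays X _]sl; apply: disjoint_drays_select dS _ _.
      by rewrite rem_uniq ?iota_uniq.
    by move=> i /lP[].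
  have /lP[ln lj] : nth 0%N l i \in l by rewrite mem_nth ?sl.
  split=> [|w e]; first exact: PS.
  by apply: lj; have [] := dS.1 _ _ _ _ ln jn (etrans e (esym ez)).
exists S => [|j jn]; first exact: disjoint_drays_le dS.
split=> [|z e]; first by apply: PS; exact: ltnW.
by apply: no; exists j; [exact: ltnW|exists z].
Qed.

Lemma rich_avoid P (X : set T) : finite_set X -> rich P ->
  rich (fun s => P s /\ within (~` X) s).
Proof.
move=> /(@finite_seqP {classic T})[l ->]; elim: l P => [|x l IH] P rP.
  by apply: rich_mono rP => s _ Ps; split.
apply: rich_mono (IH _ (rich_avoid1 x rP)) => s _ [[Ps sx] sl]; split=> // z.
by rewrite /= inE => /orP[/eqP/sx//|]; exact: sl.
Qed.

Lemma finite_window n S (N : nat) :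
  finite_set [set x | exists j z, [/\ (j < n)%N, (`|z| <= N)%N & x = S j z]].
Proof.
apply: (@sub_finite_set _ _ (\bigcup_(j in `I_n)
  ((fun k : nat => S j (k%:Z - N%:Z)) @` `I_(N + N).+1))).
  move=> x [j [z [jn zN ->]]]; exists j => //.
  exists (absz (z + N%:Z)); first by rewrite /=; lia.
  by congr (S j _); lia.
by apply: bigcup_finite => [|j _]; [exact: finite_II|exact/finite_image/finite_II].
Qed.

(** Each stage adds a double ray and keeps the old ones on a growing window, so the stages converge
    pointwise. Disjointness and edges concern two vertices at a time and are seen at a finite
    stage. *)
Lemma limit_family W (Inv : nat -> (nat -> int -> T) -> Prop) :
  (forall n S, Inv n S -> disjoint_drays n S /\ forall j, (j < n)%N -> within W (S j)) ->
  (exists S, Inv 0%N S) ->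
  (forall n S N, Inv n S -> exists2 S', Inv n.+1 S' &
     forall j z, (j < n)%N -> (`|z| <= N)%N -> S' j z = S j z) ->
  infinitely_many_drays W.
Proof.
move=> InvP [S0 Inv0] step.
pose X := {x : nat * (nat -> int -> T) | Inv x.1 x.2}.
pose R (x y : X) := (sval y).1 = (sval x).1.+1 /\
  forall j z, (j < (sval x).1)%N -> (`|z| <= (sval x).1)%N ->
    (sval y).2 j z = (sval x).2 j z.
have [|f [f0 fR]] := @dependent_choice X R _ (exist _ (0%N, S0) Inv0).
  move=> [[n S] /= InvS]; apply: cid.
  have [S' InvS' h] := step n S n InvS.
  by exists (exist (fun x => Inv x.1 x.2) (n.+1, S') InvS').
pose F t := (sval (f t)).2.
have f1 t : (sval (f t)).1 = t by elim: t => [|t IH]; rewrite ?f0 // (fR t).1 IH.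
have InvF t : Inv t (F t) by have := svalP (f t); rewrite f1.
have Fle t u j z : (t <= u)%N -> (j < t)%N -> (`|z| <= t)%N -> F u j z = F t j z.
  move=> + jt zt; elim: u => [|u IH]; first by rewrite leqn0 => /eqP ->.
  rewrite leq_eqVlt => /orP[/eqP <- //|]; rewrite ltnS => tu.
  rewrite -(IH tu) /F; apply: (fR u).2; rewrite f1; exact: leq_trans tu.
(* From stage [m j z] on, vertex [z] of double ray [j] no longer changes. *)
pose m j (z : int) := maxn j.+1 `|z|.
pose G j z := F (m j z) j z.
have GF t j z : (m j z <= t)%N -> G j z = F t j z.
  by move=> mt; rewrite /G (Fle (m j z) t) // ?leq_maxl ?leq_maxr.
exists G; first split.
- move=> i j x y; pose t := maxn (m i x) (m j y).
  have it : (i < t)%N by rewrite /t /m; lia.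
  have jt : (j < t)%N by rewrite /t /m; lia.
  rewrite (GF t) ?leq_maxl // (GF t j) ?leq_maxr // => e.
  by have [[injF _] _] := InvP _ _ (InvF t); exact: injF e.
- move=> j z; pose t := maxn (m j z) (m j (z + 1)).
  have jt : (j < t)%N by rewrite /t /m; lia.
  rewrite (GF t) ?leq_maxl // (GF t j (z + 1)) ?leq_maxr //.
  by have [[_ EF] _] := InvP _ _ (InvF t); exact: EF.
- move=> j z; have jt : (j < m j z)%N by exact: leq_maxl.
  by have [_ WF] := InvP _ _ (InvF (m j z)); exact: WF.
Qed.

Lemma infinitely_many_drays_mono V W : V `<=` W ->
  infinitely_many_drays V -> infinitely_many_drays W.
Proof. by move=> VW [S h VS]; exists S => // j z; exact/VW/VS. Qed.

Definition leaves_backwards W s : Prop :=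
  exists N : nat, forall n : nat, (N <= n)%N -> ~ W (s (- n%:Z)).

(* The negative halves never change: at each stage they lie, up to finitely
   many vertices, outside some [W] in the filter [L], so that the next double
   ray can be found away from them. *)
Lemma one_sided V (L : set (set T)) :
  L V -> (forall A B, L A -> L B -> L (A `&` B)) ->
  (forall A X, L A -> finite_set X -> L (A `\` X)) ->
  (forall W, L W -> rich (fun s =>
    (exists2 W', L W' & leaves_backwards W' s) /\ within W s)) ->
  infinitely_many_drays V.
Proof.
move=> LV LI LD Lrich.
pose P s := exists2 W', L W' & leaves_backwards W' s.
apply: (@limit_family V (fun n S => disjoint_drays n S /\
  forall j, (j < n)%N -> P (S j) /\ within V (S j))).
- by move=> n S [dS PS]; split=> // j /PS[].
- by have [S _ _] := Lrich _ LV 0%N; exists S; split; [split|].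
move=> n S N [dS PS].
(* Intersecting finitely many members of [L] gives one that all the negative halves leave. *)
have [W LW hW] : exists2 W, L W & forall j, (j < n)%N -> leaves_backwards W (S j).
  have : forall k, (k <= n)%N ->
     exists2 W, L W & forall j, (j < k)%N -> leaves_backwards W (S j).
    elim=> [_|k IH kn]; first by exists V.
    have [W LW hW] := IH (ltnW kn).
    have [[W' LW' [N' hW']] _] := PS _ kn.
    exists (W `&` W'); first exact: LI.
    move=> j; rewrite ltnS leq_eqVlt => /orP[/eqP->|/hW[N1 h]].
      by exists N' => m /hW' h [].
    by exists N1 => m /h h' [].
  by move=> /(_ n (leqnn _)).
have [M hM] : exists M : nat, (N < M)%N /\
    forall j m, (j < n)%N -> (M <= m)%N -> ~ W (S j (- m%:Z)).
  have : forall k, (k <= n)%N -> exists M : nat, (N < M)%N /\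
      forall j m, (j < k)%N -> (M <= m)%N -> ~ W (S j (- m%:Z)).
    elim=> [_|k IH kn]; first by exists N.+1.
    have [M [NM hM]] := IH (ltnW kn).
    have [M' hM'] := hW _ kn.
    exists (maxn M M'); split=> [|j m]; first by rewrite leq_max NM.
    rewrite ltnS leq_eqVlt geq_max => /orP[/eqP->|jk] /andP[Mm M'm].
      exact: hM'.
    exact: hM.
  by move=> /(_ n (leqnn _)).
case: hM => NM hM.
(* Outside [X] and inside [W], the next family misses every [S j z] with [z <= M]. *)
pose X := [set x | exists j z, [/\ (j < n)%N, (`|z| <= M)%N & x = S j z]].
have LWX : L ((V `&` W) `\` X) by apply: LD; [exact: LI|exact: finite_window].
(* Switching the [n] positive halves uses at most [n] double rays of [s], so one of [n.+1] remains
   untouched and can be added. *)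
have [s ds Ps] := Lrich _ LWX n.+1.
have sV k z : (k < n.+1)%N -> V (s k z) by move=> kn; have [_ /(_ z)[[]]] := Ps _ kn.
have off j z k w : (j < n)%N -> z <= M%:Z -> (k < n.+1)%N -> S j z <> s k w.
  move=> jn zM kn e; have [_ /(_ w)[[_ Ww] nX]] := Ps _ kn.
  case: (leP (- M%:Z) z) => Mz.
    by apply: nX; exists j, z; split=> //; lia.
  apply: (hM j `|z|%N) => //; first by lia.
  by rewrite (_ : - `|z|%N%:Z = z) ?e //; lia.
have [||||r' [B [sB injr' r'P r's nB]]] :=
  @switching_nat T E n n.+1 (fun i t => S i (M%:Z + t%:Z)) s.
- move=> i j x y ni nj /(dS.1 _ _ _ _ ni nj)[-> h]; split=> //; lia.
- exact: ds.1.
- move=> i t ni; have -> : M%:Z + t.+1%:Z = M%:Z + t%:Z + 1 by lia.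
  exact: dS.2.
- exact: ds.2.
have [k kn kB] : exists2 k, (k < n.+1)%N & k \notin B.
  apply: contrapT => h.
  have : {subset iota 0%N n.+1 <= B}.
    move=> k; rewrite mem_iota add0n => /andP[_ kn].
    by apply/negPn/negP => kB; apply: h; exists k.
  by move=> /(uniq_leq_size (iota_uniq _ _)); rewrite size_iota ltnNge sB.
pose S' j := if (j < n)%N then
  (fun z : int => if z < M%:Z then S j z else r' j (absz (z - M%:Z)%R)) else s k.
exists S'; last first.
  by move=> j z jn zN; rewrite /S' jn /= ifT //; lia.
have S'lt j z : (j < n)%N -> z < M%:Z -> S' j z = S j z by move=> jn zM; rewrite /S' jn zM.
have S'le j z : (j < n)%N -> M%:Z <= z -> S' j z = r' j (absz (z - M%:Z)%R).
  by move=> jn zM; rewrite /S' jn ltNge zM.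
have S'n j z : (n <= j)%N -> S' j z = s k z by move=> jn; rewrite /S' ltnNge jn.
have dr i x j t : (i < n)%N -> (j < n)%N -> x < M%:Z -> S i x <> r' j t.
  move=> ni nj xM; have [[j' [u [nj' ->]]]|[k' [z [nk' ->]]]] := r's _ t nj.
    by move=> /(dS.1 _ _ _ _ ni nj')[_]; lia.
  by apply: off => //; lia.
have ds' i x z : (i < n)%N -> S' i x <> s k z.
  move=> ni; case: (ltP x M%:Z) => xM.
    by rewrite S'lt //; apply: off => //; lia.
  by rewrite S'le //; exact: nB.
split; first split.
- move=> i j x y; rewrite !ltnS => lei lej.
  case: (ltnP i n) => ni; case: (ltnP j n) => nj.
  + case: (ltP x M%:Z) => xM; case: (ltP y M%:Z) => yM.
    * rewrite !S'lt //; exact: dS.1.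
    * by rewrite S'lt // S'le // => /dr; case.
    * by rewrite S'le // S'lt // => /esym/dr; case.
    * by rewrite !S'le // => /injr'; case=> // ->; split=> //; lia.
  + by rewrite (S'n j) // => /ds'; case.
  + by rewrite (S'n i) // => /esym/ds'; case.
  + rewrite !S'n // => /ds.1; case=> // _ ->; split=> //; lia.
- move=> j z; rewrite ltnS => lej; case: (ltnP j n) => nj; last first.
    by rewrite !S'n //; exact: ds.2.
  case: (ltP z M%:Z) => zM; case: (ltP (z + 1) M%:Z) => zM1.
  + by rewrite !S'lt //; exact: dS.2.
  + rewrite S'lt // S'le //; have [e _] := r'P _ nj.
    have -> : absz (z + 1 - M%:Z)%R = 0%N by lia.
    have eM : z + 1 = M%:Z + 0%N%:Z by lia.
    by rewrite e -eM; exact: dS.2.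
  + by lia.
  + rewrite !S'le //; have [_ h] := r'P _ nj.
    by rewrite (_ : absz (z + 1 - M%:Z)%R = (absz (z - M%:Z)%R).+1) //; lia.
- move=> j; rewrite ltnS => lej; case: (ltnP j n) => nj; last first.
    have -> : S' j = s k by rewrite /S' ltnNge nj.
    by split=> [|z]; [have [] := Ps _ kn|exact: sV].
  have [[W' LW' [N' h]] VS] := PS _ nj; split.
    exists W' => //; exists N'.+1 => m Nm.
    by rewrite S'lt //; [apply: h; lia|lia].
  move=> z; case: (ltP z M%:Z) => zM; first by rewrite S'lt //; exact: VS.
  rewrite S'le //; have [[j' [u [nj' ->]]]|[k' [w [nk' ->]]]] := r's _ (absz (z - M%:Z)%R) nj.
    by have [_ VS'] := PS _ nj'; exact: VS'.
  exact: sV.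
Qed.

End Families.

(** * Cuts *)

Section Crossing.
Local Open Scope ring_scope.
Variables (T : Type) (E : T -> T -> Prop).

Lemma rich_shift (P Q : (int -> T) -> Prop) :
  (forall s, dray E s -> P s -> exists a, Q (fun z => s (z + a))) ->
  rich E P -> rich E Q.
Proof.
move=> PQ rP n; have [S dS PS] := rP n.
have /choice[a ha] j : exists a, (j < n)%N -> Q (fun z => S j (z + a)).
  case: (ltnP j n) => jn; last by exists 0.
  by have [a ha] := PQ _ (disjoint_drays_dray dS jn) (PS _ jn); exists a.
exists (fun j z => S j (z + a j)) => [|j]; last exact: ha.
split=> [i j x y ni nj /(dS.1 _ _ _ _ ni nj)[ij]|j z nj].
  by subst j => /addIr.
by rewrite addrAC; exact: dS.2.
Qed.

Lemma rich_reverse (P : (int -> T) -> Prop) :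
  rich E P -> rich (fun x y => E y x) (fun s => P (fun z => s (- z))).
Proof.
move=> rP n; have [S dS PS] := rP n; exists (fun j z => S j (- z)).
  split=> [i j x y ni nj /(dS.1 _ _ _ _ ni nj)[ij /oppr_inj//]|j z nj].
  by rewrite /= opprD -[X in E _ (S j X)](addrNK 1); exact: dS.2.
by move=> j /PS; congr P; apply: funext => z; rewrite opprK.
Qed.

Lemma infinitely_many_drays_reverse (W : set T) :
  infinitely_many_drays (fun x y => E y x) W -> infinitely_many_drays E W.
Proof.
move=> [S [injS ES] WS]; exists (fun j z => S j (- z)) => [|j z]; last exact: WS.
split=> [i j x y /injS[ij /oppr_inj//]|j z].
by rewrite /= opprD -[X in E (S j X) _](addrNK 1); exact: ES.
Qed.

Definition out_closed_in (Z U : set T) : Prop :=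
  forall x y, Z x -> Z y -> U x -> E x y -> U y.

(** Positive tails are switched forwards and negative tails backwards, onto the same new family. The
    former stay in [U] and the latter outside, because no edge leaves [U]; so the two switchings
    cannot interfere. *)
Lemma crossing_infinite (Z U : set T) : out_closed_in Z U ->
  rich E (fun s => within Z s /\ forall z, U (s z) <-> 0 <= z) ->
  infinitely_many_drays E Z.
Proof.
move=> outU richZ.
apply: (@limit_family T E Z (fun n S => disjoint_drays E n S /\
  forall j, (j < n)%N -> within Z (S j) /\ forall z, U (S j z) <-> 0 <= z)).
- by move=> n S [dS PS]; split=> // j /PS[].
- by have [S dS PS] := richZ 0%N; exists S.
(* The vertices with [|z| <= N] are kept, and [M > 0] separates the two tails. *)
move=> n S N [dS PS]; pose M := N.+1.
pose X := [set x | exists j z, [/\ (j < n)%N, (`|z| <= M)%N & x = S j z]].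
(* Each of the two switchings uses at most [n] of the new double rays, so one is left over. *)
have [s ds Ps] := rich_avoid (finite_window n S M) richZ (n + n).+1.
have sZ k z : (k < (n + n).+1)%N -> Z (s k z) by move=> /Ps[[]].
have SZ j z : (j < n)%N -> Z (S j z) by move=> /PS[].
have off j z k w : (j < n)%N -> (`|z| <= M)%N -> (k < (n + n).+1)%N -> S j z <> s k w.
  by move=> jn zM /Ps[_ /(_ w) nX] e; apply: nX; exists j, z.
have [||||r [B [sB injr rP rs nB]]] :=
  @switching_nat T E n (n + n).+1 (fun i t => S i (M%:Z + t%:Z)) s.
- move=> i j x y ni nj /(dS.1 _ _ _ _ ni nj)[-> h]; split=> //; lia.
- exact: ds.1.
- move=> i t ni; have -> : M%:Z + t.+1%:Z = M%:Z + t%:Z + 1 by lia.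
  exact: dS.2.
- exact: ds.2.
(* The backward switching is the forward one for reversed edges and reversed sequences. *)
have [||||l [C [sC injl lP ls nC]]] :=
  @switching_nat T (fun x y => E y x) n (n + n).+1
    (fun i t => S i (- (M%:Z + t%:Z))) (fun k z => s k (- z)).
- move=> i j x y ni nj /(dS.1 _ _ _ _ ni nj)[-> h]; split=> //; lia.
- by move=> i j x y ni nj /(ds.1 _ _ _ _ ni nj)[-> /oppr_inj].
- move=> i t ni; have -> : - (M%:Z + t%:Z) = - (M%:Z + t.+1%:Z) + 1 by lia.
  exact: dS.2.
- by move=> k z nk; rewrite /= opprD -[X in E _ (s k X)](addrNK 1); exact: ds.2.
have rZ i t : (i < n)%N -> Z (r i t).
  by move=> ni; have [[j [u [nj ->]]]|[k [z [nk ->]]]] := rs i t ni; auto.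
have lZ i t : (i < n)%N -> Z (l i t).
  by move=> ni; have [[j [u [nj ->]]]|[k [z [nk ->]]]] := ls i t ni; auto.
have rU i t : (i < n)%N -> U (r i t).
  move=> ni; have [r0 Er] := rP i ni; elim: t => [|t IH].
    by rewrite r0; apply/(PS _ ni).2.
  by apply: outU IH (Er t); exact: rZ.
have lU i t : (i < n)%N -> ~ U (l i t).
  move=> ni; have [l0 El] := lP i ni; elim: t => [|t IH].
    by rewrite l0 => /(PS _ ni).2.
  by move=> Ul; apply: IH; apply: outU Ul (El t); exact: lZ.
have [k kn [kB kC]] : exists2 k, (k < (n + n).+1)%N & k \notin B /\ k \notin C.
  apply: contrapT => h.
  have : {subset iota 0%N (n + n).+1 <= B ++ C}.
    move=> k; rewrite mem_iota add0n mem_cat => /andP[_ kn].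
    by apply/negPn/negP; rewrite negb_or => /andP[kB kC]; apply: h; exists k.
  move=> /(uniq_leq_size (iota_uniq _ _)); rewrite size_iota size_cat.
  by rewrite ltnNge leq_add.
pose S' j := if (j < n)%N then
  (fun z : int => if M%:Z <= z then r j (absz (z - M%:Z)%R) else
     if z <= - M%:Z then l j (absz (- M%:Z - z)%R) else S j z) else s k.
have S'r j z : (j < n)%N -> M%:Z <= z -> S' j z = r j (absz (z - M%:Z)%R).
  by move=> jn zM; rewrite /S' jn zM.
have S'l j z : (j < n)%N -> z <= - M%:Z -> S' j z = l j (absz (- M%:Z - z)%R).
  by move=> jn zM; rewrite /S' jn ifF ?ifT //; apply/negP; lia.
have S'S j z : (j < n)%N -> (`|z| < M)%N -> S' j z = S j z.
  by move=> jn zM; rewrite /S' jn ifF ?ifF //; apply/negP; lia.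
have S'n j z : (n <= j)%N -> S' j z = s k z by move=> jn; rewrite /S' ltnNge jn.
have trich z : [\/ M%:Z <= z, z <= - M%:Z | (`|z| < M)%N].
  case: (leP M%:Z z) => h1; first by constructor 1.
  by case: (leP z (- M%:Z)) => h2; [constructor 2|constructor 3; lia].
have Sr i x j t : (i < n)%N -> (j < n)%N -> (`|x| < M)%N -> S i x <> r j t.
  move=> ni nj xM; have [[j' [u [nj' ->]]]|[k' [z [nk' ->]]]] := rs _ t nj.
    by move=> /(dS.1 _ _ _ _ ni nj')[_]; lia.
  by apply: off => //; lia.
have Sl i x j t : (i < n)%N -> (j < n)%N -> (`|x| < M)%N -> S i x <> l j t.
  move=> ni nj xM; have [[j' [u [nj' ->]]]|[k' [z [nk' ->]]]] := ls _ t nj.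
    by move=> /(dS.1 _ _ _ _ ni nj')[_]; lia.
  by apply: off => //; lia.
have rl i x j t : (i < n)%N -> (j < n)%N -> r i x <> l j t.
  by move=> ni nj e; apply: (lU j t nj); rewrite -e; exact: rU.
have ds' i x z : (i < n)%N -> S' i x <> s k z.
  move=> ni; case: (trich x) => xM.
  - by rewrite S'r //; exact: nB.
  - by rewrite S'l // -[z]opprK; exact: nC.
  - by rewrite S'S //; apply: off => //; lia.
exists S'; last by move=> j z jn zN; rewrite S'S.
split; first split.
- move=> i j x y; rewrite !ltnS => lei lej.
  case: (ltnP i n) => ni; case: (ltnP j n) => nj.
  + case: (trich x) => xM; case: (trich y) => yM.
    * by rewrite !S'r // => /injr; case=> // ->; split=> //; lia.
    * by rewrite S'r // S'l // => /rl; case.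
    * by rewrite S'r // S'S // => /esym/Sr; case.
    * by rewrite S'l // S'r // => /esym/rl; case.
    * by rewrite !S'l // => /injl; case=> // ->; split=> //; lia.
    * by rewrite S'l // S'S // => /esym/Sl; case.
    * by rewrite S'S // S'r // => /Sr; case.
    * by rewrite S'S // S'l // => /Sl; case.
    * rewrite !S'S //; exact: dS.1.
  + by rewrite (S'n j) // => /ds'; case.
  + by rewrite (S'n i) // => /esym/ds'; case.
  + rewrite !S'n // => /ds.1; case=> // _ ->; split=> //; lia.
- move=> j z; rewrite ltnS => lej; case: (ltnP j n) => nj; last first.
    by rewrite !S'n //; exact: ds.2.
  have [r0 Er] := rP _ nj; have [l0 El] := lP _ nj.
  case: (leP M%:Z z) => zM.
    rewrite !S'r //; last by lia.
    by rewrite (_ : absz (z + 1 - M%:Z)%R = (absz (z - M%:Z)%R).+1) //; lia.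
  case: (leP (z + 1) (- M%:Z)) => zM1.
    rewrite !S'l //; last by lia.
    rewrite (_ : absz (- M%:Z - z)%R = (absz (- M%:Z - (z + 1))%R).+1); first exact: El.
    by lia.
  (* At [M] and [- M] the switched tails begin with the old vertices, so the edges at the ends of
     the window are old ones. *)
  have hS w : (`|w| <= M)%N -> S' j w = S j w.
    rewrite leq_eqVlt => /orP[wM|]; last exact: S'S.
    case: (leP 0 w) => w0.
      rewrite S'r //; last by lia.
      have -> : absz (w - M%:Z)%R = 0%N by lia.
      by rewrite r0; congr (S j _); lia.
    rewrite S'l //; last by lia.
    have -> : absz (- M%:Z - w)%R = 0%N by lia.
    by rewrite l0; congr (S j _); lia.
  by rewrite !hS; [exact: dS.2|lia|lia].
- move=> j; rewrite ltnS => lej; case: (ltnP j n) => nj; last first.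
    have -> : S' j = s k by rewrite /S' ltnNge nj.
    by have [] := Ps _ kn.
  split=> z; case: (trich z) => zM.
  + by rewrite S'r //; exact: rZ.
  + by rewrite S'l //; exact: lZ.
  + by rewrite S'S //; exact: SZ.
  + rewrite S'r //; split=> _; first by lia.
    exact: rU.
  + rewrite S'l //; split=> [/lU|]; first by case.
    by lia.
  + by rewrite S'S //; exact: (PS _ nj).2.
Qed.

(** A double ray that avoids [X] lies in [U], lies outside [U], or enters [U] once and for all. The
    last kind cannot be rich by [crossing_infinite]. *)
Lemma cut_dichotomy (Z X U : set T) : ~ infinitely_many_drays E Z ->
  finite_set X -> out_closed_in (Z `\` X) U -> rich E (within Z) ->
  rich E (within (Z `&` U)) \/ rich E (within (Z `\` U)).
Proof.
move=> ninf finX outU /(rich_avoid finX) rZ.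
pose cross s := within (Z `\` X) s /\ exists z w, ~ U (s z) /\ U (s w).
have [||rU] := @rich_split T E _ (within (Z `&` U))
    (fun s => within (Z `\` U) s \/ cross s) _ rZ.
- move=> s _ [Zs Xs]; case: (pselect (within U s)) => [Us|/existsNP[z nUz]].
    by left=> z; split; [exact: Zs|exact: Us].
  case: (pselect (exists w, U (s w))) => [[w Uw]|nU].
    right; right; split; last by exists z, w.
    by move=> v; split; [exact: Zs|exact: Xs].
  by right; left=> w; split; [exact: Zs|move=> Uw; apply: nU; exists w].
- by left.
have [rZU|rC] := rich_split (fun s _ h => h) rU; first by right.
exfalso; apply: ninf.
apply: (@infinitely_many_drays_mono T E (Z `\` X)); first by move=> x [].
apply: (crossing_infinite outU); apply: rich_shift rC => s [_ Es] [Zs [z [w [nUz Uw]]]].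
have up x (n : nat) : U (s x) -> U (s (x + n%:Z)).
  elim: n => [|n IH] Ux; first by rewrite addr0.
  have -> : x + n.+1%:Z = x + n%:Z + 1 by lia.
  by apply: outU (IH Ux) (Es _).
have zw : z < w.
  rewrite ltNge; apply/negP => wz; apply: nUz.
  by rewrite (_ : z = w + `|z - w|%N%:Z); [exact: up|lia].
(* The first vertex in [U] after [z] becomes the new origin. *)
have ex : exists n : nat, `[< U (s (z + n%:Z)) >].
  by exists `|w - z|%N; apply/asboolP; rewrite (_ : z + _ = w) //; lia.
case: (ex_minnP ex) => -[|m] /asboolP Um minm.
  by case: nUz; move: Um; rewrite addr0.
exists (z + m.+1%:Z); split=> [v|v]; first exact: Zs.
split=> [Uv|v0]; last first.
  by rewrite (_ : v + _ = z + m.+1%:Z + `|v|%N%:Z); [exact: up|lia].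
rewrite leNgt; apply/negP => v0.
suff /asboolP/minm : U (s (z + m%:Z)) by rewrite ltnn.
rewrite (_ : z + m%:Z = v + (z + m.+1%:Z) + (absz (v + 1)%R)%:Z); first exact: up.
by lia.
Qed.

End Crossing.

(** * Reachability by walks inside a vertex set *)

Section Reach.
Variables (T : Type) (E : T -> T -> Prop).
Implicit Types (W : set T).

(** Vertices may repeat, so that walks can be concatenated; [reach_dipath] later extracts dipaths
    from shortest walks. *)
Definition walk W (x y : T) (n : nat) : Prop :=
  exists p : nat -> T, [/\ p 0 = x, p n = y, (forall i, i <= n -> W (p i)) &
    forall i, i < n -> E (p i) (p i.+1)].

Definition reach W (x y : T) : Prop := exists n, walk W x y n.

Lemma reach_refl W x : W x -> reach W x x.
Proof. by move=> Wx; exists 0, (fun=> x). Qed.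

Lemma reach_edge W x y : W x -> W y -> E x y -> reach W x y.
Proof.
move=> Wx Wy xy; exists 1, (fun i => if i is 0 then x else y).
by split=> // -[|[]].
Qed.

Lemma walk_trans W x y z n m : walk W x y n -> walk W y z m -> walk W x z (n + m).
Proof.
move=> [p [p0 pn Wp Ep]] [q [q0 qm Wq Eq]].
exists (fun i => if i <= n then p i else q (i - n)); split=> //.
- case: leqP => h; last by rewrite addKn.
  have m0 : m = 0 by lia.
  by rewrite m0 addn0 pn -q0 -qm m0.
- by move=> i im; case: leqP => h; [exact: Wp|apply: Wq; lia].
- move=> i im; case: (ltngtP i n) => h.
  + exact: Ep.
  + have -> : i.+1 - n = (i - n).+1 by lia.
    by apply: Eq; lia.
  + by subst i; rewrite subSnn pn -q0; apply: Eq; lia.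
Qed.

Lemma reach_trans W y x z : reach W x y -> reach W y z -> reach W x z.
Proof. by move=> [n xy] [m yz]; exists (n + m); exact: walk_trans xy yz. Qed.

Lemma reach_mono W W' x y : W `<=` W' -> reach W x y -> reach W' x y.
Proof.
by move=> WW [n [p [p0 pn Wp Ep]]]; exists n, p; split=> // i /Wp/WW.
Qed.

Lemma reach_dray W (s : int -> T) (z w : int) :
  (forall v, E (s v) (s (v + 1)%R)) -> (z <= w)%R ->
  (forall v, (z <= v <= w)%R -> W (s v)) -> reach W (s z) (s w).
Proof.
move=> Es zw Ws; exists (absz (w - z)%R), (fun n : nat => s (z + n%:Z)%R); split.
- by rewrite addr0.
- by congr s; lia.
- by move=> n nij; apply: Ws; lia.
- by move=> n _; rewrite (_ : z + n.+1%:Z = z + n%:Z + 1)%R //; lia.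
Qed.

(** The vertices of a single walk: each of them is linked with both ends along the walk itself. *)
Lemma reach_support W x y : reach W x y -> exists Z, [/\ finite_set Z, Z `<=` W,
  reach Z x y & forall v, Z v -> reach Z x v /\ reach Z v y].
Proof.
move=> [n [p [p0 pn Wp Ep]]].
have W1 i : i <= n -> (p @` `I_n.+1) (p i) by move=> ni; exists i.
exists (p @` `I_n.+1); split.
- exact/finite_image/finite_II.
- by move=> _ [i ni <-]; exact: Wp.
- by exists n, p.
- move=> _ [i /= ni <-]; split.
    exists i, p; split=> // j ji; first by apply: W1; lia.
    by apply: Ep; lia.
  exists (n - i), (fun j => p (i + j)); split=> [|||j ji].
  + by rewrite addn0.
  + by rewrite subnKC.
  + by move=> j ji; apply: W1; lia.
  + by rewrite addnS; apply: Ep; lia.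
Qed.

End Reach.

Lemma injective_avoids (T : Type) (a : nat -> T) (X : set T) :
  injective a -> finite_set X -> exists N, forall n, N <= n -> ~ X (a n).
Proof.
move=> inja /(@finite_seqP {classic T})[l ->]; elim: l => [|x l [N hN]].
  by exists 0.
case: (pselect (exists m, a m = x)) => [[m am]|no].
  exists (maxn N m.+1) => n; rewrite geq_max => /andP[Nn mn].
  rewrite /= inE => /orP[/eqP anx|]; last exact: hN.
  have : n = m by apply: inja; rewrite am anx.
  by lia.
exists N => n Nn; rewrite /= inE => /orP[/eqP anx|]; last exact: hN.
by apply: no; exists n.
Qed.

Lemma eventually_constant (P : nat -> Prop) N :
  (forall n, N <= n -> P n -> P n.+1) ->
  (exists M, forall n, M <= n -> P n) \/ (exists M, forall n, M <= n -> ~ P n).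
Proof.
move=> step; case: (pselect (exists2 m, N <= m & P m)) => [[m Nm Pm]|no].
  left; exists m => n /subnKC <-; elim: (n - m) => [|k IH]; first by rewrite addn0.
  by rewrite addnS; apply: step => //; lia.
by right; exists N => n Nn Pn; apply: no; exists n.
Qed.

(** * The filter of large sides *)

Section Concentrated.
Variables (T : Type) (E : T -> T -> Prop) (V : set T).
Hypothesis finitely_many : ~ infinitely_many_drays E V.
Hypothesis concentrated : forall s, dray E s -> within V s ->
  ~ rich E (within (V `\` range s)).

(** Testing every rich [Z], and not only [V], makes the large sets closed under intersection. *)
Definition large (W : set T) : Prop := forall Z, Z `<=` V ->
  rich E (within Z) -> rich E (within (Z `&` W)).

Definition cut (U : set T) : Prop :=
  exists2 X, finite_set X & out_closed_in E (V `\` X) U.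

Lemma large_setI A B : large A -> large B -> large (A `&` B).
Proof.
move=> LA LB Z ZV rZ; rewrite setIA; apply: LB; last exact: LA.
by move=> x [/ZV].
Qed.

Lemma large_setD A X : large A -> finite_set X -> large (A `\` X).
Proof.
move=> LA finX Z ZV /(LA _ ZV)/(rich_avoid finX); apply: rich_mono => s _ [As Xs] z.
by have [Zz Az] := As z; do 2!split=> //; exact: Xs.
Qed.

(** If [U] is not large, some rich [Z1] has a double ray [s] outside [U]. A rich part of [U] would
    then be rich in [V] without [s], against [concentrated]; so by the dichotomy every rich [Z] is
    rich outside [U]. *)
Lemma cut_large U : cut U -> large U \/ large (~` U).
Proof.
move=> [X finX outU].
have dich Z : Z `<=` V -> rich E (within Z) ->
    rich E (within (Z `&` U)) \/ rich E (within (Z `\` U)).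
  move=> ZV; apply: (@cut_dichotomy T E Z X) => //.
    by move=> /(infinitely_many_drays_mono ZV).
  by move=> x y [Zx Xx] [Zy Xy]; apply: outU; split=> //; exact: ZV.
case: (pselect (large U)) => [|/existsNP[Z1 /not_implyP[Z1V /not_implyP[rZ1 nr1]]]].
  by left.
right=> Z ZV rZ; case: (dich Z ZV rZ) => // rZU; exfalso.
case: (dich Z1 Z1V rZ1) => // /rich_ex[s ds Z1s].
apply: (concentrated ds); first by move=> z; have [/Z1V] := Z1s z.
apply: rich_mono rZU => s' _ Zs' z; have [Zz Uz] := Zs' z.
by split; [exact: ZV|move=> [w _ e]; have [_] := Z1s w; rewrite e].
Qed.

Definition eventually_in (W : set T) (a : nat -> T) : Prop :=
  exists N, forall n, N <= n -> W (a n).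

(** The large side of a cut may be the side that no edge leaves or its complement; both are
    tested. *)
Definition convergent (a : nat -> T) : Prop :=
  forall W, large W -> cut W \/ cut (~` W) -> eventually_in W a.

(** Once past the finite set [X], a forward sequence cannot leave [U], and a backward one cannot
    enter it. *)
Lemma cut_eventually U (a : nat -> T) : cut U -> injective a ->
  (forall n, V (a n)) ->
  (forall n, E (a n) (a n.+1)) \/ (forall n, E (a n.+1) (a n)) ->
  eventually_in U a \/ eventually_in (~` U) a.
Proof.
move=> [X finX outU] inja Va Ea; have [N hN] := injective_avoids inja finX.
have VX n : N <= n -> (V `\` X) (a n) by move=> Nn; split; [|exact: hN].
case: Ea => Ea.
  apply: (@eventually_constant _ N) => n Nn Un.
  by apply: outU Un (Ea n); apply: VX; lia.
have [|[M hM]|[M hM]] := @eventually_constant (fun n => ~ U (a n)) N.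
- by move=> n Nn nU Un; apply: nU; apply: outU Un (Ea n); apply: VX; lia.
- by right; exists M.
- by left; exists M => n /hM /contrapT.
Qed.

Lemma not_convergent (a : nat -> T) : injective a -> (forall n, V (a n)) ->
  (forall n, E (a n) (a n.+1)) \/ (forall n, E (a n.+1) (a n)) ->
  ~ convergent a -> exists2 W, large W & eventually_in (~` W) a.
Proof.
move=> inja Va Ea /existsNP[W /not_implyP[LW /not_implyP[cW nW]]].
exists W => //; case: cW => /cut_eventually /(_ inja Va Ea)[] //.
by move=> h; case: nW; move: h; rewrite setCK.
Qed.

(** What a tail of [a] reaches outside [X] is a cut containing that tail. As [a] converges, the
    complement is not large; so this set is large and [b] is eventually in it. *)
Lemma convergent_reach (a b : nat -> T) (X : set T) : injective a ->
  (forall n, V (a n)) -> convergent a -> convergent b -> finite_set X ->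
  exists i j, reach E (V `\` X) (a i) (b j).
Proof.
move=> inja Va ca cb finX; have [N hN] := injective_avoids inja finX.
pose U := [set v | exists2 i, N <= i & reach E (V `\` X) (a i) v].
have cU : cut U.
  exists X => // x y VXx VXy [i Ni ix] xy; exists i => //.
  exact: reach_trans ix (reach_edge VXx VXy xy).
have aU n : N <= n -> U (a n).
  by move=> Nn; exists n => //; apply: reach_refl; split; [|exact: hN].
case: (cut_large cU) => LU.
  have [M /(_ M (leqnn _))[i _ h]] := cb U LU (or_introl cU).
  by exists i, M.
have [|M hM] := ca _ LU; first by right; rewrite setCK.
by case: (hM (maxn M N)); [exact: leq_maxl|apply: aU; exact: leq_maxr].
Qed.

Definition pos (s : int -> T) (n : nat) : T := s n.
Definition neg (s : int -> T) (n : nat) : T := s (- n%:Z)%R.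

(** By [one_sided], within some large [W1] the double rays whose negative halves do not converge are
    not rich; [W2] does the same for positive halves. In [W1]&[W2] the remaining ones must be
    rich. *)
Lemma rich_convergent : rich E (within V) ->
  rich E (fun s => (convergent (pos s) /\ convergent (neg s)) /\ within V s).
Proof.
move=> rV.
have LV : large V by move=> Z ZV; apply: rich_mono => s _ Zs z; split; [|apply: ZV].
pose P1 s := exists2 W, large W & leaves_backwards W s.
pose P2 s := exists2 W, large W & eventually_in (~` W) (pos s).
have [W1 LW1 nr1] : exists2 W, large W & ~ rich E (fun s => P1 s /\ within W s).
  apply: contrapT => h; apply: finitely_many.
  apply: (one_sided LV large_setI large_setD) => W LW.
  by apply: contrapT => nr; apply: h; exists W.
have [W2 LW2 nr2] : exists2 W, large W & ~ rich E (fun s => P2 s /\ within W s).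
  apply: contrapT => h; apply: finitely_many.
  (* Reversing all edges turns positive halves into negative ones, so [one_sided] applies again. *)
  apply: infinitely_many_drays_reverse.
  apply: (one_sided LV large_setI large_setD) => W LW.
  have : rich E (fun s => P2 s /\ within W s).
    by apply: contrapT => nr; apply: h; exists W.
  move=> /rich_reverse; apply: rich_mono => s _ [[W' LW' h'] Ws]; split.
    by exists W'.
  by move=> z; have := Ws (- z)%R; rewrite opprK.
have r12 := large_setI LW1 LW2 (@subset_refl _ _) rV.
have [|r3 //|] := @rich_split T E _ (fun s => (convergent (pos s) /\ convergent (neg s))
   /\ within V s) (fun s => (P1 s /\ within W1 s) \/ (P2 s /\ within W2 s)) _ r12.
- move=> s [injs Es] Vs.
  have Vs' z : V (s z) by have [] := Vs z.
  case: (pselect (convergent (pos s))) => cp; last first.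
    right; right; split; last by move=> z; have [_ []] := Vs z.
    apply: not_convergent cp.
    + by move=> m n /injs; lia.
    + by move=> n; exact: Vs'.
    + by left=> n; rewrite /pos -addn1 PoszD; exact: Es.
  case: (pselect (convergent (neg s))) => cn; first by left.
  right; left; split; last by move=> z; have [_ []] := Vs z.
  apply: not_convergent cn.
  + by move=> m n /injs; lia.
  + by move=> n; exact: Vs'.
  + right=> n; rewrite /neg (_ : (- n%:Z = - n.+1%:Z + 1)%R); [exact: Es|lia].
- by move=> /(rich_split (fun s _ h => h))[].
Qed.

End Concentrated.

(** * The one-ended subdigraph *)

(* Strong connectedness outside of finite sets would be too much to ask: it fails
   already when [V] is a single ray. *)
Definition hub (T : Type) (E : T -> T -> Prop) (V : set T) (a : nat -> T) : Prop :=
  forall X, finite_set X -> exists2 Y, finite_set Y & forall v, V v -> ~ Y v ->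
    (exists i, reach E (V `\` X) v (a i)) /\ (exists i, reach E (V `\` X) (a i) v).

Section Hub.
Variables (T : Type) (E : T -> T -> Prop) (V : set T) (e : nat -> T).
Hypothesis Ve : V `<=` range e.

Let initial (n : nat) : set T := e @` `I_n.

Lemma finite_initial n : finite_set (initial n).
Proof. exact/finite_image/finite_II. Qed.

Lemma initial_le m n : m <= n -> initial m `<=` initial n.
Proof. by move=> mn _ [i im <-]; exists i => //; exact: leq_trans mn. Qed.

(** Hence a subset of [V] that lies outside [initial m] for large [m] is far from any given finite
    set. *)
Lemma initial_exhausts X : finite_set X -> exists m, X `&` V `<=` initial m.
Proof.
move=> /(@finite_seqP {classic T})[l ->]; elim: l => [|x l [m hm]].
  by exists 0 => x [].
case: (pselect (V x)) => [/Ve[i _ ei]|nVx].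
  exists (maxn m i.+1) => y [/= + Vy]; rewrite inE => /orP[/eqP ->|yl].
    by exists i => //=; rewrite leq_max ltnSn orbT.
  apply: initial_le (leq_maxl _ _) _ _; exact: hm.
exists m => y [/= + Vy]; rewrite inE => /orP[/eqP yx|yl]; first by case: nVx; rewrite -yx.
exact: hm.
Qed.

Variable Good : (int -> T) -> Prop.

Definition half (b : bool) (s : int -> T) : nat -> T := if b then pos s else neg s.

Hypothesis reach_half : forall s t b c X, dray E s -> within V s -> Good s ->
  dray E t -> within V t -> Good t -> finite_set X ->
  exists i j, reach E (V `\` X) (half b s i) (half c t j).

(** [V'] is the union of families [F n] of [n] double rays outside [initial n] and of finite linking
    sets [Z m] outside [initial m]. A finite [X] disturbs only finitely many of these pieces, each
    in finitely many vertices. *)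
Lemma hub_exists : rich E (fun s => Good s /\ within V s) ->
  exists V' s, [/\ V' `<=` V, rich E (within V'), dray E s, within V' s &
    hub E V' (pos s)].
Proof.
move=> rG.
have /choice[F hF] n : exists S, disjoint_drays E n S /\
    forall j, j < n -> Good (S j) /\ within V (S j) /\ within (~` initial n) (S j).
  have [S dS PS] := rich_avoid (finite_initial n) rG n.
  by exists S; split=> // j /PS[[]].
have dF n i : i < n -> dray E (F n i).
  exact: disjoint_drays_dray (hF n).1.
have VF n i : i < n -> within V (F n i) by move=> /(hF n).2[_ []].
have GF n i : i < n -> Good (F n i) by move=> /(hF n).2[].
have nF n i : i < n -> within (~` initial n) (F n i) by move=> /(hF n).2[_ []].
pose a := pos (F 1 0).
(* [Z m] joins both halves of every double ray in the [F n] with [n <= m] to and from [a]. By the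
   last clause each vertex of [Z m] is linked within [Z m] from and to vertices of double rays. *)
have /choice[Z hZ] m : exists Z, [/\ finite_set Z, Z `<=` V `\` initial m,
    (forall n i b, i < n <= m -> (exists u v, reach E Z (half b (F n i) u) (a v)) /\
      (exists u v, reach E Z (a u) (half b (F n i) v))) &
    (forall v, Z v ->
      (exists n i z, i < n /\ reach E Z (F n i z) v) /\
      (exists n i z, i < n /\ reach E Z v (F n i z)))].
  have /choice[Q hQ] (t : nat * nat * bool) : exists Q, [/\ finite_set Q,
    Q `<=` V `\` initial m,
    (t.1.2 < t.1.1 ->
      (exists u v, reach E Q (half t.2 (F t.1.1 t.1.2) u) (a v)) /\
      (exists u v, reach E Q (a u) (half t.2 (F t.1.1 t.1.2) v))) &
    (forall v, Q v ->
      (exists n i z, i < n /\ reach E Q (F n i z) v) /\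
      (exists n i z, i < n /\ reach E Q v (F n i z)))].
    case: t => -[n i] b /=.
    case: (ltnP i n) => lin; last by exists set0; split=> // v [].
    have halfF c n' i' u : exists z, half c (F n' i') u = F n' i' z.
      by case: c; eexists.
    have [u [v ruv0]] := @reach_half (F n i) (F 1 0) b true _
      (dF _ _ lin) (VF _ _ lin) (GF _ _ lin) (dF 1 0 isT) (VF 1 0 isT) (GF 1 0 isT)
      (finite_initial m).
    have [Q [fQ QV ruv hQ]] := reach_support ruv0.
    have [u' [v' ruv0']] := @reach_half (F 1 0) (F n i) true b _
      (dF 1 0 isT) (VF 1 0 isT) (GF 1 0 isT) (dF _ _ lin) (VF _ _ lin) (GF _ _ lin)
      (finite_initial m).
    have [Q' [fQ' QV' ruv' hQ']] := reach_support ruv0'.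
    have QQ := @subsetUl _ Q Q'; have QQ' := @subsetUr _ Q Q'.
    have [z hz] := halfF b n i u; have [z' hz'] := halfF b n i v'.
    exists (Q `|` Q'); split.
    - by rewrite finite_setU.
    - by move=> x [/QV|/QV'].
    - move=> _; split; first by exists u, v; exact: reach_mono ruv.
      by exists u', v'; exact: reach_mono ruv'.
    - move=> x [/hQ[r1 r2]|/hQ'[r1 r2]]; split.
      + by exists n, i, z; split=> //; rewrite -hz; exact: reach_mono r1.
      + by exists 1, 0, v; split=> //; exact: reach_mono r2.
      + by exists 1, 0, u'; split=> //; exact: reach_mono r1.
      + by exists n, i, z'; split=> //; rewrite -hz'; exact: reach_mono r2.
  pose I := ('I_m.+1 * 'I_m.+1 * bool)%type.
  pose q (t : I) := (val t.1.1, val t.1.2, t.2).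
  have sub t : Q (q t) `<=` \bigcup_(t in [set: I]) Q (q t) by move=> x Qx; exists t.
  exists (\bigcup_(t in [set: I]) Q (q t)); split.
  - by apply: bigcup_finite => [|t _]; [exact: finite_finset|case: (hQ (q t))].
  - by move=> x [t _]; case: (hQ (q t)) => _ + _ _; apply.
  - move=> n i b /andP[lin nm].
    have nm' : n < m.+1 by rewrite ltnS.
    have im' : i < m.+1 by exact: leq_trans (ltnW nm').
    have := sub (Ordinal nm', Ordinal im', b); rewrite /q /= => sub'.
    have [_ _ /(_ lin)[[u [v r1]] [u' [v' r2]]] _] := hQ (n, i, b).
    by split; [exists u, v|exists u', v']; apply: reach_mono sub' _.
  - move=> v [t _ Qv]; have [_ _ _ /(_ _ Qv)] := hQ (q t).
    move=> [[n [i [z [lin r1]]]] [n' [i' [z' [lin' r2]]]]].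
    by split; [exists n, i, z|exists n', i', z']; split=> //; apply: reach_mono (sub t) _.
pose V' := [set x | exists n i z, i < n /\ x = F n i z] `|` [set x | exists m, Z m x].
have V'F n i z : i < n -> V' (F n i z) by move=> lin; left; exists n, i, z.
have V'Z m : Z m `<=` V' by move=> x Zx; right; exists m.
have V'V : V' `<=` V.
  move=> x [[n [i [z [lin ->]]]]|[m Zx]]; first exact: VF.
  by have [_ /(_ _ Zx)[]] := hZ m.
exists V', (F 1 0); split=> //.
- move=> n; exists (F n); first exact: (hF n).1.
  by move=> j jn z; exact: V'F.
- exact: dF.
- by move=> z; exact: V'F.
move=> X finX; have [m0 hm0] := initial_exhausts finX.
(* For large [m], the walks in [Z m] avoid [X] and the first [N] vertices of the half, so they touch
   it beyond [N]. *)
have far n i b N : i < n ->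
    (exists u v, N <= u /\ reach E (V' `\` X) (half b (F n i) u) (a v)) /\
    (exists u v, N <= v /\ reach E (V' `\` X) (a u) (half b (F n i) v)).
  move=> lin.
  pose w := [set half b (F n i) u | u in `I_N].
  have [m1 hm1] : exists m, w `&` V `<=` initial m.
    exact/initial_exhausts/finite_image/finite_II.
  pose m := maxn n (maxn m0 m1).
  have [_ Zm /(_ n i b)[]] := hZ m.
    by rewrite lin /m; lia.
  move=> [u [v r1]] [u' [v' r2]] _.
  have ZVX : Z m `<=` V' `\` X.
    move=> x Zx; split=> [|Xx]; first exact: V'Z Zx.
    have [Vx] := Zm x Zx; apply; apply: (@initial_le m0); first by rewrite /m; lia.
    exact: hm0.
  have off j : Z m (half b (F n i) j) -> N <= j.
    move=> Zj; have [Vj nj] := Zm _ Zj; rewrite leqNgt; apply/negP => jN; apply: nj.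
    apply: (@initial_le m1); first by rewrite /m; lia.
    by apply: hm1; split=> //; exists j.
  have ends x y : reach E (Z m) x y -> Z m x /\ Z m y.
    by move=> [k [p [<- <- Zp _]]]; split; apply: Zp.
  split; [exists u, v|exists u', v']; split; try exact: reach_mono ZVX _.
    by apply: off; have [] := ends _ _ r1.
  by apply: off; have [] := ends _ _ r2.
pose ok v := (exists i, reach E (V' `\` X) v (a i)) /\
             (exists i, reach E (V' `\` X) (a i) v).
have along n i z w : i < n -> (z <= w)%R ->
    (forall v, (z <= v <= w)%R -> ~ X (F n i v)) ->
    reach E (V' `\` X) (F n i z) (F n i w).
  move=> lin zw h; apply: reach_dray => //; first exact: (dF _ _ lin).2.
  by move=> v zvw; split; [exact: V'F|exact: h].
have okF n i : i < n -> exists M : nat, forall z, ~ (n <= m0 /\ `|z| < M) -> ok (F n i z).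
  move=> lin; case: (leqP n m0) => nm0; last first.
    (* [F n i] avoids [X]: from any vertex go forward to a contact on the positive half, and arrive
       there from a contact far back on the negative half. *)
    exists 0 => z _.
    have avoid v : ~ X (F n i v).
      move=> Xv; apply: (nF n i lin v); apply: (@initial_le m0); first exact: ltnW.
      by apply: hm0; split=> //; exact: VF.
    have [[u [v [zu r1]]] _] := far n i true `|z|%N lin.
    have [_ [u' [v' [zv r2]]]] := far n i false `|z|%N lin.
    split.
      exists v; apply: reach_trans r1; apply: along => //; lia.
    exists u'; apply: reach_trans r2 _; apply: along => //; lia.
  have [injF _] := dF _ _ lin.
  have injh b : injective (half b (F n i)).
    by case: b => x y /injF; lia.
  have [N1 hN1] := injective_avoids (injh true) finX.
  have [N2 hN2] := injective_avoids (injh false) finX.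
  have hp v : (N1%:Z%R <= v)%R -> ~ X (F n i v).
    by move=> Nv; rewrite (_ : v = Posz `|v|%N); [apply: hN1|]; lia.
  have hn v : (v <= - N2%:Z)%R -> ~ X (F n i v).
    by move=> Nv; rewrite (_ : v = (- Posz `|v|%N)%R); [apply: hN2|]; lia.
  (* An entry [v3] on the positive half and an exit [u2] on the negative half, both past [X].
     Vertices beyond [v3] are reached through it, and vertices before [- u2] leave through it; the
     other direction uses contacts still further out. *)
  have [_ [u3 [v3 [N3 r3]]]] := far n i true N1 lin.
  have [[u2 [v2 [N2u r2]]] _] := far n i false N2 lin.
  exists (maxn v3 u2).+1 => z hz.
  have {}hz : maxn v3 u2 < `|z| by rewrite ltnNge; apply/negP => h; apply: hz.
  case: (leP 0%R z) => z0.
    have [[u [v [zu r1]]] _] := far n i true `|z|%N lin.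
    split.
      exists v; apply: reach_trans r1; apply: along => //; first by lia.
      by move=> x zx; apply: hp; lia.
    exists u3; apply: reach_trans r3 _; apply: along => //; first by lia.
    by move=> x zx; apply: hp; lia.
  have [_ [u [v [zu r1]]]] := far n i false `|z|%N lin.
  split.
    exists v2; apply: reach_trans r2; apply: along => //; first by lia.
    by move=> x zx; apply: hn; lia.
  exists u; apply: reach_trans r1 _; apply: along => //; first by lia.
  by move=> x zx; apply: hn; lia.
have /choice[M hM] (t : nat * nat) : exists M : nat, t.2 < t.1 ->
    forall z, ~ (t.1 <= m0 /\ `|z| < M) -> ok (F t.1 t.2 z).
  case: (ltnP t.2 t.1) => h; last by exists 0.
  by have [M hM] := okF _ _ h; exists M.
pose I := ('I_m0.+1 * 'I_m0.+1)%type.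
(* Only the [F n] with [n <= m0] have exceptional windows; [finite_window] treats all [j <= i] at
   once. *)
pose Y1 := \bigcup_(t in [set: I]) [set x | exists j z,
  [/\ j < (val t.2).+1, `|z| <= M (val t.1, val t.2) & x = F (val t.1) j z]].
have finY1 : finite_set Y1.
  by apply: bigcup_finite => [|t _]; [exact: finite_finset|exact: finite_window].
have okY1 n i z : i < n -> ~ Y1 (F n i z) -> ok (F n i z).
  move=> lin nY; apply: (hM (n, i)) => //= -[nm zM]; apply: nY.
  have nm' : n < m0.+1 by rewrite ltnS.
  have im' : i < m0.+1 by exact: leq_trans (ltnW nm').
  by exists (Ordinal nm', Ordinal im') => //; exists i, z; split=> //; exact: ltnW.
(* From [m1] on, [Z m] avoids [X] and [Y1], so its vertices are linked to vertices of double rays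
   for which [ok] holds. *)
have [m1 hm1] : exists m, (X `|` Y1) `&` V `<=` initial m.
  by apply: initial_exhausts; rewrite finite_setU.
exists (Y1 `|` \bigcup_(m in `I_m1) Z m).
  rewrite finite_setU; split=> //; apply: bigcup_finite; first exact: finite_II.
  by move=> m _; have [] := hZ m.
move=> v V'v nYv.
have nY1 : ~ Y1 v by move=> h; apply: nYv; left.
case: V'v => [[n [i [z [lin vE]]]]|[m Zv]].
  by move: nY1; rewrite vE; exact: okY1.
have m1m : m1 <= m.
  by rewrite leqNgt; apply/negP => mm; apply: nYv; right; exists m.
have [_ Zm _ /(_ _ Zv)[[n [i [z [lin r1]]]] [n' [i' [z' [lin' r2]]]]]] := hZ m.
have ZXY x : Z m x -> ~ (X `|` Y1) x.
  move=> Zx XYx; have [Vx] := Zm x Zx; apply; apply: (@initial_le m1) => //.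
  exact: hm1.
have ZVX : Z m `<=` V' `\` X.
  by move=> x Zx; split=> [|Xx]; [exact: V'Z Zx|apply: (ZXY x Zx); left].
have ends x y : reach E (Z m) x y -> Z m x /\ Z m y.
  by move=> [k [p [<- <- Zp _]]]; split; apply: Zp.
have [|_ [j rj]] := okY1 n i z lin.
  by move=> h; apply: (ZXY (F n i z)); [have [] := ends _ _ r1|right].
have [|[j' rj'] _] := okY1 n' i' z' lin'.
  by move=> h; apply: (ZXY (F n' i' z')); [have [] := ends _ _ r2|right].
split; first by exists j'; apply: reach_trans rj'; exact: reach_mono ZVX r2.
by exists j; apply: reach_trans rj _; exact: reach_mono ZVX r1.
Qed.

End Hub.

(** Otherwise double rays could be deleted one after the other for ever, and the deleted ones would
    be infinitely many disjoint double rays. *)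
Lemma concentrated_exists (T : Type) (E : T -> T -> Prop) (V0 : set T) :
  ~ infinitely_many_drays E V0 -> rich E (within V0) ->
  exists V, [/\ V `<=` V0, rich E (within V) &
    forall s, dray E s -> within V s -> ~ rich E (within (V `\` range s))].
Proof.
move=> ninf rV0; apply: contrapT => h; apply: ninf.
pose X := {V : set T | V `<=` V0 /\ rich E (within V)}.
pose R (x y : X) := exists s, [/\ dray E s, within (sval x) s &
  sval y = sval x `\` range s].
have [|f [_ fR]] := @dependent_choice X R _ (exist _ V0 (conj (@subset_refl _ V0) rV0)).
  move=> [V [VV0 rV]]; apply: cid; apply: contrapT => no; apply: h.
  exists V; split=> // s ds Vs r; apply: no.
  have VV : V `\` range s `<=` V0 by move=> x [/VV0].
  by exists (exist _ (V `\` range s) (conj VV r)), s.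
have /choice[s hs] n := fR n.
have sub m n : m <= n -> sval (f n) `<=` sval (f m).
  move=> /subnKC <-; elim: (n - m) => [|k IH]; first by rewrite addn0.
  by rewrite addnS; have [_ _ ->] := hs (m + k) => x [/IH].
have disj m n x y : m < n -> s m x <> s n y.
  move=> mn e; have [_ Vs _] := hs n; have := sub _ _ mn _ (Vs y).
  by have [_ _ ->] := hs m; case=> _; apply; exists x.
exists s => [|n z]; last first.
  by have [_ Vs _] := hs n; have [V0f _] := svalP (f n); exact/V0f/Vs.
split=> [m n x y e|n z]; last by have [[_ Es] _ _] := hs n; exact: Es.
case: (ltngtP m n) => mn.
- by case: (disj _ _ _ _ mn e).
- by case: (disj _ _ _ _ mn (esym e)).
- by subst n; have [[injs _] _ _] := hs m; split=> //; exact: injs.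
Qed.

(** The union [V0] of one family of each finite size is still rich and is countable, as the
    enumeration in [hub_exists] demands. *)
Lemma hub_in_rich (T : Type) (E : T -> T -> Prop) (W : set T) :
  ~ infinitely_many_drays E W -> rich E (within W) ->
  exists V s, [/\ V `<=` W, rich E (within V), dray E s, within V s & hub E V (pos s)].
Proof.
move=> ninf rW.
have /choice[F hF] n : exists S, disjoint_drays E n S /\
  forall j, j < n -> within W (S j) by have [S dS PS] := rW n; exists S.
pose V0 := [set x | exists n i z, i < n /\ x = F n i z].
pose e (t : nat) := if unpickle t is Some (n, i, z) then F n i z else F 0 0 0%R.
have V0e : V0 `<=` range e.
  by move=> x [n [i [z [_ ->]]]]; exists (pickle (n, i, z)); rewrite // /e pickleK.
have V0W : V0 `<=` W by move=> x [n [i [z [lin ->]]]]; exact: (hF n).2.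
have rV0 : rich E (within V0).
  by move=> n; exists (F n); [exact: (hF n).1|move=> j jn z; exists n, j, z].
have ninf0 : ~ infinitely_many_drays E V0 by move=> /(infinitely_many_drays_mono V0W).
have [V [VV0 rV conc]] := concentrated_exists ninf0 rV0.
have ninfV : ~ infinitely_many_drays E V by move=> /(infinitely_many_drays_mono VV0).
have Ve : V `<=` range e by move=> x /VV0/V0e.
pose good s := convergent E V (pos s) /\ convergent E V (neg s).
have [||V' [s [V'V rV' ds V's hs]]] := @hub_exists T E V e Ve good.
- move=> s t b c X [injs _] Vs [ps ns] _ _ [pt nt].
  apply: (convergent_reach ninfV conc).
  + by case: b => m n /injs; lia.
  + by move=> n; case: b; exact: Vs.
  + by case: b.
  + by case: c.
- exact: rich_convergent.
by exists V', s; split=> // x /V'V/VV0/V0W.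
Qed.

(** From a far vertex of [A] go to the hub, follow the hub past [X], and leave it for a far vertex
    of [B]. *)
Lemma hub_reach (T : Type) (E : T -> T -> Prop) (V A B X : set T) (a : nat -> T) :
  (forall n, E (a n) (a n.+1)) -> injective a -> (forall n, V (a n)) -> hub E V a ->
  A `<=` V -> B `<=` V -> infinite_set A -> infinite_set B -> finite_set X ->
  exists x y, [/\ A x, B y & reach E (V `\` X) x y].
Proof.
move=> Ea inja Va hubV AV BV infA infB finX.
have [N hN] := injective_avoids inja finX.
have fina M : finite_set (a @` `I_M) by exact/finite_image/finite_II.
have inf_ex (C Y : set T) : infinite_set C -> finite_set Y -> exists2 x, C x & ~ Y x.
  move=> infC finY; apply: contrapT => h; apply: infC; apply: sub_finite_set finY.
  by move=> x Cx; apply: contrapT => nYx; apply: h; exists x.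
have beyond M i v : (reach E (V `\` (X `|` a @` `I_M)) (a i) v \/
    reach E (V `\` (X `|` a @` `I_M)) v (a i)) -> M <= i.
  move=> h; rewrite leqNgt; apply/negP => iM.
  have : (V `\` (X `|` a @` `I_M)) (a i).
    by case: h => -[n [p [p0 pn Wp _]]]; [rewrite -p0|rewrite -pn]; exact: Wp.
  by case=> _; apply; right; exists i.
have sub M : V `\` (X `|` a @` `I_M) `<=` V `\` X.
  by move=> x [Vx nx]; split=> // Xx; apply: nx; left.
have [|Y finY hY] := hubV (X `|` a @` `I_N); first by rewrite finite_setU.
have [x Ax nYx] := inf_ex _ _ infA finY.
have [[i ri] _] := hY x (AV _ Ax) nYx.
have Ni := beyond N i x (or_intror ri).
(* Removing the first [i] hub vertices forces the exit [j] not to precede the entry [i]. *)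
have [|Y' finY' hY'] := hubV (X `|` a @` `I_i); first by rewrite finite_setU.
have [y By nYy] := inf_ex _ _ infB finY'.
have [_ [j rj]] := hY' y (BV _ By) nYy.
have ij := beyond i j y (or_introl rj).
exists x, y; split=> //.
apply: reach_trans (reach_mono (sub N) ri) _.
apply: reach_trans _ (reach_mono (sub i) rj).
exists (j - i), (fun n => a (i + n)); split.
- by rewrite addn0.
- by rewrite subnKC.
- by move=> n _; split=> //; apply: hN; lia.
- by move=> n _; rewrite addnS.
Qed.

(** A walk of least length from [A] to [B] repeats no vertex and has no inner vertex in [A] or
    [B]. *)
Lemma reach_dipath (T : Type) (D : digraph T) (W A B : set T) (x y : T) :
  W `<=` verts D -> A x -> B y -> reach (edge D) W x y ->
  exists n (p : 'I_n.+1 -> T), dipath_between D A B p /\ range p `<=` W.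
Proof.
move=> WD Ax By [k xyk].
pose P n := `[< exists x y, [/\ A x, B y & walk (edge D) W x y n] >].
have exP : exists n, P n by exists k; apply/asboolP; exists x, y.
case: (ex_minnP exP) => n /asboolP[{Ax By xyk}x [{}y [Ax By [p [p0 pn Wp Ep]]]]] minn.
have lt_walk m u v : A u -> B v -> walk (edge D) W u v m -> n <= m.
  by move=> Au Bv uv; apply: minn; apply/asboolP; exists u, v.
have pre i : i <= n -> walk (edge D) W x (p i) i.
  move=> ni; exists p; split=> // j ji; first by apply: Wp; lia.
  by apply: Ep; lia.
have suf i : i <= n -> walk (edge D) W (p i) y (n - i).
  move=> ni; exists (fun j => p (i + j)); split=> [|||j ji].
  - by rewrite addn0.
  - by rewrite subnKC.
  - by move=> j ji; apply: Wp; lia.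
  - by rewrite addnS; apply: Ep; lia.
have injp i j : i < j -> j <= n -> p i <> p j.
  move=> ij jn e; have ni : i <= n by lia.
  have wi := pre i ni; rewrite e in wi.
  by have := lt_walk _ _ _ Ax By (walk_trans wi (suf j jn)); lia.
exists n, (fun i => p i); split; last by move=> _ [i _ <-]; apply: Wp; rewrite -ltnS.
split; first split.
- move=> i j e; apply: val_inj => /=; case: (ltngtP i j) => // ij.
  + by case: (injp i j ij _ e); rewrite -ltnS.
  + by case: (injp j i ij _ (esym e)); rewrite -ltnS.
- by move=> i; apply/WD/Wp; rewrite -ltnS.
- by move=> i j ji; rewrite ji; apply: Ep; rewrite -ltnS -ji.
- by rewrite p0.
- by rewrite pn.
- move=> i i0 imax.
  have ni : i <= n by rewrite -ltnS.
  have i_gt0 : 0 < i by rewrite lt0n; apply/eqP => h; apply: i0; exact: val_inj.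
  have i_ltn : i < n.
    by rewrite ltn_neqAle ni andbT; apply/eqP => h; apply: imax; exact: val_inj.
  case=> [Ai|Bi].
    by have := lt_walk _ _ _ Ai By (suf i ni); lia.
  by have := lt_walk _ _ _ Ax Bi (pre i ni); lia.
Qed.

Lemma finite_range_ord (T : Type) n (p : 'I_n -> T) : finite_set (range p).
Proof. exact/finite_image/finite_finset. Qed.

(** Greedy choice: each dipath avoids the finite union of the earlier ones. *)
Lemma reach_ray_le (T : Type) (D Q R : digraph T) :
  (forall X, finite_set X -> exists x y,
    [/\ verts Q x, verts R y & reach (edge D) (verts D `\` X) x y]) ->
  ray_le D Q R.
Proof.
move=> h.
pose path := {n : nat & 'I_n.+1 -> T}.
pose X := {x : set T * path | finite_set x.1}.
pose step (x y : X) := [/\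
  dipath_between D (verts Q) (verts R) (projT2 (sval y).2),
  range (projT2 (sval y).2) `<=` ~` (sval x).1 &
  (sval y).1 = (sval x).1 `|` range (projT2 (sval y).2)].
have [x0 _] := h _ (finite_set0 T).
have [|f [_ fstep]] := @dependent_choice X step _
    (exist _ (set0, existT _ 0 (fun=> x0)) (finite_set0 T)).
  move=> [[Y q] /= finY]; apply: cid.
  have [x [y [Qx Ry r]]] := h _ finY.
  have [|n [p [dp pY]]] := reach_dipath _ Qx Ry r; first by move=> v [].
  have finYp : finite_set (Y `|` range p).
    by rewrite finite_setU; split=> //; exact: finite_range_ord.
  exists (exist (fun x : set T * path => finite_set x.1)
    (Y `|` range p, existT _ n p) finYp); split=> //=.
  by move=> v /pY[].
exists (fun k => projT1 (sval (f k.+1)).2), (fun k => projT2 (sval (f k.+1)).2).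
split=> [k|]; first by have [] := fstep k.
have sub m n : m <= n -> (sval (f m)).1 `<=` (sval (f n)).1.
  move=> /subnKC <-; elim: (n - m) => [|k IH]; first by rewrite addn0.
  by rewrite addnS; have [_ _ ->] := fstep (m + k) => x /IH; left.
have disj k l x : k < l -> range (projT2 (sval (f k.+1)).2) x ->
    range (projT2 (sval (f l.+1)).2) x -> False.
  move=> kl kx lx; have [_ /(_ _ lx) nx _] := fstep l; apply: nx.
  by apply: (sub k.+1 l kl); have [_ _ ->] := fstep k; right.
move=> k l _ _ [x [kx lx]]; case: (ltngtP k l) => // kl.
- by case: (disj _ _ _ kl kx lx).
- by case: (disj _ _ _ kl lx kx).
Qed.

(** * Rays, and digraphs with exactly one end *)

Lemma card_eq_I1 (T : Type) (A : set T) : (A #= `I_1)%card <-> exists x, A = [set x].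
Proof.
split=> [/card_set_bijP[f [ff injf sf]]|[x ->]]; last exact: card_set1.
have [x Ax fx] := sf 0 isT; exists x; apply/seteqP; split=> [y Ay|y ->//].
apply: injf; rewrite ?inE //; rewrite fx.
by have := ff _ Ay; rewrite /=; case: (f y).
Qed.

Lemma degree_next (T : Type) (e : T -> T -> Prop) (V : set T) :
  (forall x, V x -> ([set y | e x y] #= `I_1)%card) ->
  exists f : T -> T, forall x, V x -> e x (f x) /\ forall y, e x y -> y = f x.
Proof.
move=> h.
have /choice[f hf] x : exists y, V x -> e x y /\ forall z, e x z -> z = y.
  case: (pselect (V x)) => [/h/card_eq_I1[y yE]|nV]; last by exists x.
  exists y => _; split; first by have : [set y] y by []; rewrite -yE.
  by move=> z xz; have : [set y | e x y] z by []; rewrite yE.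
by exists f.
Qed.

Lemma injective_infinite (T : Type) (a : nat -> T) (V : set T) :
  injective a -> (forall n, V (a n)) -> infinite_set V.
Proof. by move=> inja Va /(injective_avoids inja)[N /(_ N (leqnn _))]; exact. Qed.

(** Following out-edges from the origin never repeats a vertex: tracing a repetition back along the
    unique in-edges would give an edge into the origin. *)
Lemma ray_infinite (T : Type) (G : digraph T) : ray G -> infinite_set (verts G).
Proof.
move=> [v [[[Vv out_v in_v] _] _ deg]].
have [|f hf] := @degree_next T (edge G) (verts G).
  by move=> x Vx; case: (pselect (x = v)) => [->//|/(deg x Vx)[]].
have [|g hg] := @degree_next T (fun x y => edge G y x) [set x | verts G x /\ x <> v].
  by move=> x [Vx /(deg x Vx)[]].
have nov x : ~ edge G x v.
  by move=> xv; move: in_v; rewrite /indeg II0 card_eq0 => /eqP/seteqP[/(_ x xv)].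
pose a n := iter n f v.
have Va n : verts G (a n).
  by elim: n => //= n IH; have [/(@edge_verts _ G)[]] := hf _ IH.
have Ea n : edge G (a n) (a n.+1) by have [] := hf _ (Va n).
have neq m n : m < n -> a m <> a n.
  elim: m n => [|m IH] [//|n] mn e; first by apply: (nov (a n)); rewrite -[v]/(a 0) e.
  apply: (IH n mn).
  have nv : a m.+1 <> v by move=> h; apply: (nov (a m)); rewrite -h.
  have [_ hg'] := hg (a m.+1) (conj (Va _) nv).
  by rewrite (hg' _ (Ea m)) (hg' (a n)) // e; exact: Ea.
apply: injective_infinite Va => m n e; case: (ltngtP m n) => // mn.
- by case: (neq _ _ mn e).
- by case: (neq _ _ mn (esym e)).
Qed.

Section RayOfSequence.
Variables (T : Type) (D : digraph T) (a : nat -> T).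
Hypotheses (inja : injective a) (Ea : forall n, edge D (a n) (a n.+1)).

Definition sequence_edge (x y : T) : Prop := exists n, x = a n /\ y = a n.+1.

Lemma sequence_edge_verts x y : sequence_edge x y -> range a x /\ range a y.
Proof. by move=> [n [-> ->]]. Qed.

Lemma sequence_edge_irrefl x : ~ sequence_edge x x.
Proof. by move=> [n [-> /inja]]; lia. Qed.

Definition sequence_digraph : digraph T :=
  Digraph sequence_edge_verts sequence_edge_irrefl.

Lemma sequence_digraph_sub : subdigraph sequence_digraph D.
Proof.
split=> [_ [n _ <-]|_ _ [n [-> ->]]]; last exact: Ea.
by have [] := edge_verts (Ea n).
Qed.

Lemma sequence_digraph_ray : ray sequence_digraph.
Proof.
have out n : outdeg sequence_digraph (a n) 1.
  apply/card_eq_I1; exists (a n.+1); apply/seteqP; split=> [y [m [/inja -> //]]|y ->].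
  by exists n.
have inS n : indeg sequence_digraph (a n.+1) 1.
  apply/card_eq_I1; exists (a n); apply/seteqP; split=> [y [m [-> /inja[->]//]]|y ->].
  by exists n.
have in0 : indeg sequence_digraph (a 0) 0.
  rewrite /indeg II0 card_eq0; apply/eqP/seteqP; split=> // y [m [_ /inja]].
  by [].
exists (a 0); split.
- split; first by split=> //; exists 0.
  move=> _ [[[|n] _ <-] // _ h]; exfalso.
  have : [set y | edge sequence_digraph y (a n.+1)] (a n) by exists n.
  by move: h; rewrite /indeg II0 card_eq0 => /eqP ->.
- move=> _ [n _ <-]; exists n, (fun i => a i); split=> //; split.
  + by move=> i j /inja/val_inj.
  + by move=> i; exists i.
  + by move=> i j ->; exists i.
- by move=> _ [[|n] _ <-] // _; split.
Qed.

End RayOfSequence.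

(** Rays and anti-rays are infinite, so [hub_reach] makes any two of them equivalent; the hub is
    itself a ray, so an end exists. *)
Lemma hub_one_ended (T : Type) (D : digraph T) (s : int -> T) :
  dray (edge D) s -> hub (edge D) (verts D) (pos s) -> one_ended D.
Proof.
move=> [injs Es] hubD.
have injp : injective (pos s) by move=> m n /injs; lia.
have Ep n : edge D (pos s n) (pos s n.+1).
  by rewrite /pos -addn1 PoszD; exact: Es.
have Vp n : verts D (pos s n) by have [] := edge_verts (Ep n).
have inf Q : ray_or_antiray_in D Q -> verts Q `<=` verts D /\ infinite_set (verts Q).
  by move=> [[sub _]] [/ray_infinite|/ray_infinite]; split.
have le Q R : ray_or_antiray_in D Q -> ray_or_antiray_in D R -> ray_le D Q R.
  move=> /inf[QD infQ] /inf[RD infR]; apply: reach_ray_le => X.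
  exact: hub_reach Ep injp Vp hubD QD RD infQ infR.
have aR : ray_or_antiray_in D (sequence_digraph injp).
  by split; [exact: sequence_digraph_sub|left; exact: sequence_digraph_ray].
exists [set Q | ray_or_antiray_in D Q /\ ray_equiv D Q (sequence_digraph injp)].
split; first by exists (sequence_digraph injp).
move=> w [R hR ->]; apply/seteqP; split=> Q [hQ _]; split=> //; split; exact: le.
Qed.

(** * Double rays as sequences *)

Section DoubleRays.
Local Open Scope ring_scope.

Definition traces (T : Type) (G : digraph T) (s : int -> T) : Prop :=
  [/\ injective s, verts G = range s &
    forall x y, edge G x y <-> exists z, x = s z /\ y = s (z + 1)].

Lemma traces_double_ray (T : Type) (G : digraph T) (s : int -> T) :
  traces G s -> double_ray G.
Proof.
move=> [injs VG EG]; split.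
- apply: (@injective_infinite _ (pos s)) => [m n /injs|n]; first by lia.
  by rewrite VG; exists n%:Z.
- move=> v; rewrite VG => -[z _ <-]; split; apply/card_eq_I1.
    exists (s (z + 1)); apply/seteqP; split=> [y /EG[w [/injs <- //]]|y ->].
    by apply/EG; exists z.
  exists (s (z - 1)); apply/seteqP; split=> [y /EG[w [-> /injs ->]]|y ->].
    by rewrite /= addrK.
  by apply/EG; exists (z - 1); rewrite subrK.
- have link a b : a <= b -> linked G (s a) (s b).
    move=> ab; exists (absz (b - a)), (fun i => s (a + (nat_of_ord i)%:Z)); split.
    + split=> [i j /injs/addrI[] /val_inj //|i|i j ij].
        by rewrite VG; exists (a + (nat_of_ord i)%:Z).
      by apply/EG; exists (a + (nat_of_ord i)%:Z); split=> //; congr s; lia.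
    + by rewrite /= addr0.
    + by congr s; rewrite /=; lia.
  move=> v w; rewrite VG => -[a _ <-] [b _ <-].
  by case: (leP a b) => ab; [left|right]; apply: link; lia.
Qed.

Lemma linked_walk (T : Type) (G : digraph T) x y : linked G x y ->
  exists n, walk (edge G) setT x y n.
Proof.
move=> [n [p [[_ _ Ep] <- <-]]]; exists n, (fun i => p (inord i)); split=> //.
- by congr p; apply: val_inj; rewrite /= inordK.
- by congr p; apply: val_inj; rewrite /= inordK.
- by move=> i ni; apply: Ep; rewrite !inordK //; lia.
Qed.

(** Successor and predecessor maps are mutually inverse, and [s] iterates them from any vertex.
    Linkedness makes [s] surjective; a repetition would close a cycle and make [G] finite. *)
Lemma double_ray_traces (T : Type) (G : digraph T) :
  double_ray G -> exists s, traces G s.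
Proof.
move=> [infG deg link].
have [|f hf] := @degree_next T (edge G) (verts G); first by move=> x /deg[].
have [|g hg] := @degree_next T (fun x y => edge G y x) (verts G); first by move=> x /deg[].
have Vf x : verts G x -> verts G (f x) by move=> /hf[/(@edge_verts _ G)[]].
have Vg x : verts G x -> verts G (g x) by move=> /hg[/(@edge_verts _ G)[]].
have fg x : verts G x -> f (g x) = x.
  by move=> Vx; have [_ h] := hf _ (Vg _ Vx); rewrite -(h x) //; have [] := hg _ Vx.
have gf x : verts G x -> g (f x) = x.
  by move=> Vx; have [_ h] := hg _ (Vf _ Vx); rewrite -(h x) //; have [] := hf _ Vx.
have /infinite_setN0[v0 V0] := infG.
(* [Negz n] is the integer [- n.+1], hence [n.+1] predecessor steps. *)
pose s (z : int) := match z with Posz n => iter n f v0 | Negz n => iter n.+1 g v0 end.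
have Vfn n : verts G (iter n f v0) by elim: n => // n; exact: Vf.
have Vgn n : verts G (iter n g v0) by elim: n => // n; exact: Vg.
have Vs z : verts G (s z) by case: z => n; [exact: Vfn|exact: (Vgn n.+1)].
have sS z : s (z + 1) = f (s z).
  case: z => n; first by rewrite (_ : Posz n + 1 = Posz n.+1) //; lia.
  rewrite [in RHS]/s /= fg //.
  by case: n => [|n] //; rewrite (_ : Negz n.+1 + 1 = Negz n) //; lia.
have sP z : s (z - 1) = g (s z) by rewrite -{2}(subrK 1 z) sS gf.
have Es z : edge G (s z) (s (z + 1)) by rewrite sS; have [] := hf _ (Vs z).
have VG : verts G = range s.
  apply/seteqP; split=> [w Vw|_ [z _ <-] //].
  have [/(@linked_walk _ G)[n [p [p0 pn _ Ep]]]|/(@linked_walk _ G)[n [p [p0 pn _ Ep]]]] :=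
    link v0 w V0 Vw.
    exists n%:Z => //; rewrite -pn.
    have : forall i, (i <= n)%N -> s i%:Z = p i.
      elim=> [_|i IH ni]; first by rewrite p0.
      have e := IH (ltnW ni); have [_ h] := hf _ (Vs i%:Z).
      by rewrite -addn1 PoszD sS -(h (p i.+1)) ?addn1 // e; exact: Ep.
    by apply.
  exists (- n%:Z) => //; rewrite -p0.
  have : forall i, (i <= n)%N -> s (- i%:Z) = p (n - i)%N.
    elim=> [_|i IH ni]; first by rewrite subn0 pn.
    have e := IH (ltnW ni); have [_ h] := hg _ (Vs (- i%:Z)).
    rewrite -addn1 PoszD opprD sP -(h (p (n - i.+1)%N)) ?addn1 //.
    by rewrite e (_ : (n - i = (n - i.+1).+1)%N); [apply: Ep|]; lia.
  by move=> /(_ n (leqnn n)); rewrite subnn.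
have neq a b : a < b -> s a <> s b.
  move=> ab e; apply: infG.
  (* If [s a = s b], this finite segment is closed under successor and predecessor and so contains
     every vertex. *)
  pose P v := exists2 w, a <= w < b & v = s w.
  have Pf v : P v -> P (f v).
    move=> [w /andP[aw wb] ->]; rewrite -sS; case: (ltP (w + 1) b) => h.
      by exists (w + 1) => //; apply/andP; split=> //; lia.
    by exists a; [rewrite lexx|rewrite e; congr s; lia].
  have Pg v : P v -> P (g v).
    move=> [w /andP[aw wb] ->]; rewrite -sP; case: (leP a (w - 1)) => h.
      by exists (w - 1) => //; apply/andP; split=> //; lia.
    exists (b - 1); first by apply/andP; split; lia.
    by rewrite (_ : w = a) ?sP ?e //; lia.
  have P0 : P (s a) by exists a => //; rewrite lexx.
  have Pr (n : nat) : P (s (a + n%:Z)).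
    elim: n => [|n IH]; first by rewrite addr0.
    by rewrite (_ : a + n.+1%:Z = a + n%:Z + 1); [rewrite sS; exact: Pf|lia].
  have Pl (n : nat) : P (s (a - n%:Z)).
    elim: n => [|n IH]; first by rewrite subr0.
    by rewrite (_ : a - n.+1%:Z = a - n%:Z - 1); [rewrite sP; exact: Pg|lia].
  apply: (@sub_finite_set _ _ ((fun n : nat => s (a + n%:Z)) @` `I_(absz (b - a)))).
    rewrite VG => _ [z _ <-].
    have [w /andP[aw wb] ->] : P (s z).
      case: (leP a z) => az.
        by rewrite (_ : z = a + (absz (z - a))%:Z) //; lia.
      by rewrite (_ : z = a - (absz (a - z))%:Z) //; lia.
    by exists (absz (w - a)); [rewrite /=; lia|congr s; lia].
  exact/finite_image/finite_II.
exists s; split=> // [a b e|x y].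
  by case: (ltgtP a b) => // ab; [case: (neq _ _ ab e)|case: (neq _ _ ab (esym e))].
split=> [xy|[z [-> ->]]]; last exact: Es.
have [] := edge_verts xy; rewrite VG => -[z _ xE] _.
exists z; split=> //; rewrite sS; have [_] := hf _ (Vs z); apply.
by rewrite xE.
Qed.

Lemma traces_dray (T : Type) (D G : digraph T) (s : int -> T) :
  subdigraph G D -> traces G s -> dray (edge D) s.
Proof.
move=> [_ sub] [injs _ EG]; split=> // z; apply: sub; apply/EG.
by exists z.
Qed.

Section DigraphOfDray.
Variables (T : Type) (D : digraph T) (s : int -> T).
Hypothesis ds : dray (edge D) s.

Definition dray_edge (x y : T) : Prop := exists z, x = s z /\ y = s (z + 1).

Lemma dray_edge_verts x y : dray_edge x y -> range s x /\ range s y.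
Proof. by move=> [z [-> ->]]. Qed.

Lemma dray_edge_irrefl x : ~ dray_edge x x.
Proof. by have [injs _] := ds; move=> [z [-> /injs]]; lia. Qed.

Definition dray_digraph : digraph T := Digraph dray_edge_verts dray_edge_irrefl.

Lemma dray_digraph_traces : traces dray_digraph s.
Proof. by have [injs _] := ds; split. Qed.

Lemma dray_digraph_sub : subdigraph dray_digraph D.
Proof.
have [_ Es] := ds; split=> [_ [z _ <-]|_ _ [z [-> ->]]]; last exact: Es.
by have [] := edge_verts (Es z).
Qed.

End DigraphOfDray.

Lemma traces_isomorphic (U T : Type) (H : digraph U) (G : digraph T)
    (s : int -> U) (t : int -> T) : traces H s -> traces G t -> isomorphic H G.
Proof.
move=> [injs VH EH] [injt VG EG].
have Vs z : s z \in verts H by apply/mem_set; rewrite VH; exists z.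
have Vt z : t z \in verts G by apply/mem_set; rewrite VG; exists z.
have Hs u : verts H u -> exists z, s z = u by rewrite VH => -[z _ <-]; exists z.
have Gt u : verts G u -> exists z, t z = u by rewrite VG => -[z _ <-]; exists z.
have /choice[i hi] (x : verts H) : exists z, s z = val x by exact: Hs (set_valP x).
have /choice[j hj] (y : verts G) : exists z, t z = val y by exact: Gt (set_valP y).
exists (fun x => SigSub (Vt (i x))).
  exists (fun y => SigSub (Vs (j y))) => x; apply: val_inj => /=.
    by rewrite -hi; congr s; apply: injt; rewrite hj.
  by rewrite -hj; congr t; apply: injs; rewrite hi.
move=> x y; rewrite /= -(hi x) -(hi y); split=> [/EH|/EG] [z [/[swap]]].
- by move=> /injs -> /injs ->; apply/EG; exists z.
- by move=> /injt -> /injt ->; apply/EH; exists z.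
Qed.

Lemma isomorphic_traces (U T : Type) (H : digraph U) (G : digraph T)
    (s : int -> U) : traces H s -> isomorphic H G -> exists t, traces G t.
Proof.
move=> [injs VH EH] [f [g fK gK] Ef].
have Vs z : s z \in verts H by apply/mem_set; rewrite VH; exists z.
have Hs u : verts H u -> exists z, s z = u by rewrite VH => -[z _ <-]; exists z.
have sur (x : verts H) : exists z, x = SigSub (Vs z).
  by have [z e] := Hs _ (set_valP x); exists z; apply: val_inj.
exists (fun z => val (f (SigSub (Vs z)))); split.
- by move=> x y /val_inj/(can_inj fK)/(congr1 val)/injs.
- apply/seteqP; split=> [y Vy|_ [z _ <-]]; last exact: set_valP.
  have [z zE] := sur (g (SigSub (mem_set Vy))).
  by exists z => //; rewrite -zE gK.
- move=> x y; split=> [xy|[z [-> ->]]]; last by apply/Ef/EH; exists z.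
  have [Vx Vy] := edge_verts xy.
  have [z zE] := sur (g (SigSub (mem_set Vx))).
  have [w wE] := sur (g (SigSub (mem_set Vy))).
  have fz : val (f (SigSub (Vs z))) = x by rewrite -zE gK.
  have fw : val (f (SigSub (Vs w))) = y by rewrite -wE gK.
  have /EH[v [/injs zv /injs wv]] : edge H (s z) (s w).
    by apply/(Ef (SigSub (Vs z)) (SigSub (Vs w))); rewrite fz fw.
  by exists v; rewrite -fz -fw; split; congr (val (f _)); apply: val_inj => /=; congr s.
Qed.

End DoubleRays.

(** * Translation to digraphs and the equivalence *)

Lemma isomorphic_double_ray (U T : Type) (H : digraph U) (G : digraph T) :
  double_ray H -> isomorphic H G <-> double_ray G.
Proof.
move=> /double_ray_traces[s ts]; split=> [/(isomorphic_traces ts)[t]|].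
  exact: traces_double_ray.
by move=> /double_ray_traces[t tt]; exact: traces_isomorphic ts tt.
Qed.

Lemma contains_disjoint_sub (I T : Type) (P Q : digraph T -> Prop) (D D' : digraph T) :
  subdigraph D D' -> (forall G, P G -> Q G) ->
  contains_disjoint I P D -> contains_disjoint I Q D'.
Proof.
move=> [VV EE] PQ [F [hF disj]]; exists F; split=> // i.
have [[VF EF] PF] := hF i; split; last exact: PQ.
by split=> [x /VF/VV|x y /EF/EE].
Qed.

Section Induced.
Variables (T : Type) (D : digraph T) (V : set T).

Definition induced_edge (x y : T) : Prop := [/\ edge D x y, V x & V y].

Lemma induced_edge_verts x y : induced_edge x y -> V x /\ V y.
Proof. by case. Qed.

Lemma induced_edge_irrefl x : ~ induced_edge x x.
Proof. by move=> [xx _ _]; exact: edge_irrefl xx. Qed.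

Definition induced : digraph T := Digraph induced_edge_verts induced_edge_irrefl.

Lemma induced_sub : V `<=` verts D -> subdigraph induced D.
Proof. by move=> VD; split=> // x y []. Qed.

Lemma induced_dray s : dray (edge D) s -> within V s -> dray (edge induced) s.
Proof. by move=> [injs Es] Vs; split=> // z; split. Qed.

Lemma induced_reach X x y :
  reach (edge D) (V `\` X) x y -> reach (edge induced) (V `\` X) x y.
Proof.
move=> [n [p [p0 pn Wp Ep]]]; exists n, p; split=> // i ni.
have [|Vi _] := Wp i; first exact: ltnW.
by have [Vi' _] := Wp i.+1 ni; split=> //; exact: Ep.
Qed.

Lemma induced_hub a : hub (edge D) V a -> hub (edge induced) V a.
Proof.
move=> h X /h[Y finY hY]; exists Y => // v Vv /(hY v Vv)[[i ri] [j rj]].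
by split; [exists i|exists j]; exact: induced_reach.
Qed.

End Induced.

Lemma rich_contains (T : Type) (D : digraph T) :
  rich (edge D) (within (verts D)) <->
  forall n, contains_disjoint 'I_n (@double_ray T) D.
Proof.
split=> [rD n|h n].
  have [S dS VS] := rD n.
  pose F (i : 'I_n) := dray_digraph (disjoint_drays_dray dS (ltn_ord i)).
  exists F; split=> [i|i j _ _ [x [[z _ zx] [w _ wx]]]].
    split; first exact: dray_digraph_sub.
    exact/traces_double_ray/dray_digraph_traces.
  have [e _] := dS.1 _ _ z w (ltn_ord i) (ltn_ord j) (etrans zx (esym wx)).
  exact: val_inj.
have [F [hF disj]] := h n.
have /choice[s hs] i : exists s, traces (F i) s.
  by have [_ /double_ray_traces] := hF i.
(* [s1] is the default for indices from [n] on; it comes from the family of size one, since that of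
   size [n] may be empty. *)
have [F1 [/(_ ord0)[_ /double_ray_traces[s1 _]] _]] := h 1.
exists (fun j => if insub j is Some i then s i else s1); last first.
  move=> j jn z; rewrite insubT; have [[VV _] _] := hF (Ordinal jn).
  by apply: VV; have [_ -> _] := hs (Ordinal jn); exists z.
split=> [i j x y ni nj|j z jn]; last first.
  by rewrite insubT; have [] := traces_dray (hF _).1 (hs (Ordinal jn)).
rewrite !insubT => e.
have ij : Ordinal ni = Ordinal nj.
  apply: disj => //; exists (s (Ordinal ni) x).
  have [_ -> _] := hs (Ordinal ni); have [_ -> _] := hs (Ordinal nj).
  by split; [exists x|exists y].
split; first by have := congr1 val ij.
by have [injs _ _] := hs (Ordinal ni); apply: injs; rewrite e ij.
Qed.

Lemma infinitely_many_contains (T : Type) (D : digraph T) :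
  infinitely_many_drays (edge D) (verts D) -> contains_disjoint nat (@double_ray T) D.
Proof.
move=> [S [injS ES] _].
have dS i : dray (edge D) (S i) by split=> [x y /injS[]|].
exists (fun i => dray_digraph (dS i)); split=> [i|i j _ _ [x [[z _ <-] [w _]]]].
  split; first exact: dray_digraph_sub.
  exact/traces_double_ray/dray_digraph_traces.
by move=> /injS[].
Qed.

(** If [D] had no infinite family, the subdigraph induced on a hub set would be one-ended and rich,
    and the assumption would give an infinite family inside it. *)
Lemma infinite_of_one_ended (T : Type) (D : digraph T) :
  (forall D' : digraph T, one_ended D' ->
    (forall n, contains_disjoint 'I_n (@double_ray T) D') ->
    contains_disjoint nat (@double_ray T) D') ->
  (forall n, contains_disjoint 'I_n (@double_ray T) D) ->
  contains_disjoint nat (@double_ray T) D.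
Proof.
move=> oneended /rich_contains rD.
case: (pselect (infinitely_many_drays (edge D) (verts D))) => [|ninf].
  exact: infinitely_many_contains.
have [V [s [VD rV ds Vs hubV]]] := hub_in_rich ninf rD.
apply: (contains_disjoint_sub (induced_sub VD) (fun _ h => h)).
apply: oneended.
  apply: (hub_one_ended (induced_dray ds Vs)).
  exact: induced_hub.
apply/rich_contains => n; have [S dS VS] := rV n; exists S => //.
split=> [|j z jn]; first exact: dS.1.
by split; [exact: dS.2|exact: VS|exact: VS].
Qed.

Theorem theorem1p2 :
  (forall (U : Type) (H : digraph U), double_ray H ->
     (ubiquitous H <-> ubiquitous_in (@one_ended) H)) /\
  ((forall (T : Type) (D : digraph T),
      (forall n : nat, contains_disjoint 'I_n (@double_ray T) D) ->
      contains_disjoint nat (@double_ray T) D) <->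
   (forall (T : Type) (D : digraph T), one_ended D ->
      (forall n : nat, contains_disjoint 'I_n (@double_ray T) D) ->
      contains_disjoint nat (@double_ray T) D)).
Proof.
split=> [U H dH|]; last first.
  split=> [h T D _|h T D]; first exact: h.
  by apply: infinite_of_one_ended => D'; exact: h.
split=> h T D; first by move=> _; exact: h.
move=> _ hD.
(* The copies of [H] are exactly the double rays, so both forms of ubiquity translate. *)
have iso (G : digraph T) := isomorphic_double_ray G dH.
have sub (D' : digraph T) : subdigraph D' D' by split.
have to_iso I D' := @contains_disjoint_sub I T _ _ D' D' (sub D') (fun G => (iso G).2).
have of_iso I D' := @contains_disjoint_sub I T _ _ D' D' (sub D') (fun G => (iso G).1).
apply/to_iso/infinite_of_one_ended => [D' oneD' hD'|n]; last exact/of_iso.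
by apply: of_iso; apply: h oneD' _ => n; exact/to_iso.
Qed.
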